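(* Let $G$ be a group, $\ell$ a commutative unital ring with involution containing $\lambda$ with $\lambda+\lambda^*=1$, and let $R$ be a unital strongly $G$-graded $*$-algebra over $\ell$. Then the $*$-homomorphism $R_1\to G\,\widehat{\ltimes}\,R$, $a\mapsto\chi_1\,\widehat{\ltimes}\,a$, is a $kk^h$-equivalence, i.e. its image under $j^h$ is an isomorphism in $kk^h$.
   Context: $\ell$-algebras are associative, not necessarily unital. A $*$-algebra is an $\ell$-algebra with additive involution with $(ab)^*=b^*a^*$, $(\mu a)^*=\mu^*a^*$. A $G$-graded $*$-algebra is a $*$-algebra $R=\bigoplus_gR_g$ with $R_gR_h\subset R_{gh}$, $R_g^*\subset R_{g^{-1}}$; it is strongly graded if $R_gR_h=R_{gh}$ for all $g,h\in G$. $R_1$ is the component of degree $1\in G$. Crossed product. $G\,\widehat{\ltimes}\,R=\ell^{(G)}\otimes R$ as a module, with elements $\chi_g\,\widehat{\ltimes}\,b$, product $(\chi_g\,\widehat{\ltimes}\,b)(\chi_h\,\widehat{\ltimes}\,c)=\delta_{h,g|b|}\chi_g\,\widehat{\ltimes}\,bc$ and involution $(\chi_g\,\widehat{\ltimes}\,b)^*=\chi_{g|b|}\,\widehat{\ltimes}\,b^*$ for $b$ homogeneous of degree $|b|$. The category $kk^h$. Fix an infinite set $\mathfrak{X}$ with $\#\mathfrak{X}\ge\#(G\sqcup\mathbb{N})$. A functor on $*$-algebras is $M_{\mathfrak{X}}$-stable if it inverts the corner inclusions $A\to M_{\mathfrak{X}}A$, $a\mapsto\varepsilon_{x,x}\otimes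 a$ ($M_{\mathfrak X}A$: finitely supported matrices with conjugate-transpose involution); $\iota_+$-stable if it inverts the upper-left corner inclusions $A\to M_\pm A$, where $M_\pm A=M_2A$ with involution $x\mapsto hx^*h$, $h=\mathrm{diag}(1,-1)$; homotopy invariant if it inverts $A\to A[t]$ ($t^*=t$). An excisive homology theory is a functor $H$ to a triangulated category with maps $\partial:\Omega H(C)\to H(A)$ ($\Omega$ the inverse suspension), for each exact sequence of $*$-algebras $0\to A\to B\to C\to0$ with an $\ell$-linear section of $B\to C$, compatible with morphisms of extensions, making $\Omega H(C)\to H(A)\to H(B)\to H(C)$ distinguished. $j^h$, from $*$-algebras to $kk^h$, is the initial homotopy invariant, $M_{\mathfrak{X}}$-stable, $\iota_+$-stable excisive homology theory (identity on objects). *)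

(* Defs.v *)
From HB Require Import structures.
From mathcomp Require Import all_boot monoid all_order all_algebra.
From mathcomp Require Import finmap all_classical.

Set Implicit Arguments.
Unset Strict Implicit.
Unset Printing Implicit Defensive.

Import GRing.Theory.
Local Open Scope ring_scope.
Local Open Scope classical_set_scope.

(* The module A^(I) of finitely supported functions I -> A is used as a model *)
(* of l^(I) (x) A; [delta i a] is the elementary tensor chi_i (x) a.          *)
Section FinSupp.
Variables (l : comPzRingType) (I : choiceType) (A : lmodType l).

Definition fs_pred : {pred I -> A} :=
  fun f => `[< finite_set [set i | f i <> 0] >].

Lemma fs_submod : submod_closed fs_pred.
Proof.
split=> [|c f g /asboolP hf /asboolP hg]; apply/asboolP.
  by apply: (sub_finite_set _ (@finite_set0 I)) => i /=; apply.
apply: (@sub_finite_set _ _ ([set i | f i <> 0] `|` [set i | g i <> 0])).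
  move=> i /= h; apply: contrapT => /not_orP[/contrapT hfi /contrapT hgi].
  apply: h; by rewrite [LHS](_ : _ = c *: f i + g i)// hfi hgi scaler0 addr0.
by rewrite finite_setU.
Qed.

HB.instance Definition _ :=
  GRing.isSubmodClosed.Build l (I -> A) fs_pred fs_submod.

Record fs := Fs { fs_val :> I -> A; _ : fs_val \in fs_pred }.
HB.instance Definition _ := [isSub for fs_val].
HB.instance Definition _ := [Choice of fs by <:].
HB.instance Definition _ := [SubChoice_isSubLmodule of fs by <:].

Lemma fsP (f g : fs) : (forall i, f i = g i) -> f = g.
Proof. by move=> h; apply/val_inj/funext. Qed.

Lemma fsDE (f g : fs) i : (f + g) i = f i + g i.
Proof. by []. Qed.
Lemma fsZE c (f : fs) i : (c *: f) i = c *: f i.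
Proof. by []. Qed.

Lemma fs_fin (f : fs) : finite_set [set i | f i <> 0].
Proof. by case: f => f /= /asboolP. Qed.

Lemma delta_subproof i a : (fun j => if j == i then a else 0) \in fs_pred.
Proof.
apply/asboolP; apply: (sub_finite_set _ (finite_set1 i)) => j /=.
by case: eqP.
Qed.
Definition delta i a : fs := Fs (delta_subproof i a).

Lemma deltaE i a j : delta i a j = if j == i then a else 0.
Proof. by []. Qed.

Lemma delta_linear i : linear (delta i).
Proof.
move=> c a b; apply: fsP => j.
rewrite [RHS](_ : _ = c *: delta i a j + delta i b j)// !deltaE.
by case: eqP => // _; rewrite scaler0 addr0.
Qed.
HB.instance Definition _ i :=
  GRing.isLinear.Build l A fs _ (delta i) (delta_linear i).

Lemma fs_expand (f : fs) :
  f = \sum_(i <- fset_set [set i | f i <> 0]) delta i (f i).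
Proof.
apply: fsP => j.
have sumE (r : seq I) (F : I -> fs) : (\sum_(i <- r) F i) j = \sum_(i <- r) F i j.
  by elim: r => [|i r IH]; rewrite ?big_nil ?big_cons// -IH.
rewrite sumE.
have [hj|hj] := boolP (j \in fset_set [set i | f i <> 0]).
  rewrite (big_fsetD1 j)// deltaE eqxx big1_fset => [|i].
    exact/esym/addr0.
  by rewrite !inE => /andP[hi _] _; rewrite deltaE eq_sym (negPf hi).
rewrite big1_fset => [|i hi _].
  move: hj; rewrite in_fset_set; last exact: fs_fin.
  by rewrite notin_setE /= => /contrapT.
by rewrite deltaE; case: eqP => // ji; move: hj; rewrite ji hi.
Qed.

Lemma fs_ind (P : fs -> Prop) : P 0 -> (forall i a, P (delta i a)) ->
  (forall f g, P f -> P g -> P (f + g)) -> forall f, P f.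
Proof. by move=> P0 Pd PD f; rewrite [f]fs_expand; apply: big_ind. Qed.

(* The linear extension to A^(I) of a family of additive maps psi_i : A -> V. *)
Definition fslin (V : zmodType) (psi : I -> A -> V) (f : fs) : V :=
  \sum_(i \in [set: I]) psi i (f i).

Section FsLin.
Variables (V : zmodType) (psi : I -> A -> V).
Hypothesis psiD : forall i a b, psi i (a + b) = psi i a + psi i b.

Let psi0 i : psi i 0 = 0.
Proof. by apply: (addrI (psi i 0)); rewrite -psiD !addr0. Qed.

Lemma fslinE (f : fs) (r : {fset I}) : (forall i, f i <> 0 -> i \in r) ->
  fslin psi f = \sum_(i <- r) psi i (f i).
Proof.
move=> hr; rewrite /fslin (fsbigTE r)// => i; apply: contraNeq => /eqP h.
by apply: hr => fi0; apply: h; rewrite fi0.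
Qed.

Lemma fslinD (f g : fs) : fslin psi (f + g) = fslin psi f + fslin psi g.
Proof.
pose r := fset_set ([set i | f i <> 0] `|` [set i | g i <> 0]).
have inr i : (i \in r) <-> (f i <> 0 \/ g i <> 0).
  by rewrite in_fset_set ?inE//; rewrite finite_setU; split; exact: fs_fin.
rewrite !(@fslinE _ r).
- by rewrite -big_split; apply: eq_bigr => i _; exact: psiD.
- by move=> i h; apply/inr; right.
- by move=> i h; apply/inr; left.
- move=> i h; apply/inr; apply: contrapT => /not_orP[/contrapT hf /contrapT hg].
  apply: h; by rewrite [LHS](_ : _ = f i + g i)// hf hg addr0.
Qed.

Lemma fslin0 : fslin psi 0 = 0.
Proof. by apply: (addrI (fslin psi 0)); rewrite -fslinD !addr0. Qed.

Lemma fslin_delta i a : fslin psi (delta i a) = psi i a.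
Proof.
rewrite (@fslinE _ [fset i]%fset) ?big_seq_fset1 ?deltaE ?eqxx// => j.
by rewrite deltaE inE; case: eqP.
Qed.

End FsLin.

Lemma fslinZ (V : lmodType l) (psi : I -> A -> V) (s : l -> l) :
  (forall i a b, psi i (a + b) = psi i a + psi i b) ->
  (forall i c a, psi i (c *: a) = s c *: psi i a) ->
  forall c f, fslin psi (c *: f) = s c *: fslin psi f.
Proof.
move=> psiD psiZ c; elim/fs_ind => [|i a|f g IHf IHg].
- by rewrite scaler0 fslin0// scaler0.
- by rewrite -linearZ/= !fslin_delta.
- by rewrite scalerDr !fslinD// IHf IHg scalerDr.
Qed.

(* The bilinear product on A^(I) determined by                                *)
(* delta i a * delta j b = phi i j a b.                                       *)
Definition fsmul (phi : I -> I -> A -> A -> fs) (f g : fs) : fs :=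
  fslin (fun i a => fslin (fun j b => phi i j a b) g) f.

Section FsMul.
Variable phi : I -> I -> A -> A -> fs.
Hypothesis phiDl : forall i j a a' b,
  phi i j (a + a') b = phi i j a b + phi i j a' b.
Hypothesis phiDr : forall i j a b b',
  phi i j a (b + b') = phi i j a b + phi i j a b'.
Hypothesis phiZl : forall i j c a b, phi i j (c *: a) b = c *: phi i j a b.
Hypothesis phiZr : forall i j c a b, phi i j a (c *: b) = c *: phi i j a b.

Let aux g i a a' : fslin (fun j b => phi i j (a + a') b) g =
  fslin (fun j b => phi i j a b) g + fslin (fun j b => phi i j a' b) g.
Proof.
elim/fs_ind: g => [|j b|f g IHf IHg].
- by rewrite !fslin0 ?addr0// => ? ? ?; rewrite phiDr.
- by rewrite !fslin_delta// => ? ? ?; rewrite phiDr.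
- rewrite !fslinD ?IHf ?IHg 1?addrACA// => ? ? ?; rewrite phiDr//.
Qed.

Lemma fsmulDl f f' g : fsmul phi (f + f') g = fsmul phi f g + fsmul phi f' g.
Proof. by rewrite /fsmul fslinD. Qed.

Lemma fsmul_deltal i a g : fsmul phi (delta i a) g = fslin (fun j b => phi i j a b) g.
Proof. by rewrite /fsmul fslin_delta. Qed.

Lemma fsmul_delta i a j b : fsmul phi (delta i a) (delta j b) = phi i j a b.
Proof. by rewrite fsmul_deltal fslin_delta// => k x y; rewrite phiDr. Qed.

Lemma fsmul0l g : fsmul phi 0 g = 0.
Proof. by apply: (addrI (fsmul phi 0 g)); rewrite -fsmulDl !addr0. Qed.

Lemma fsmulDr f g g' : fsmul phi f (g + g') = fsmul phi f g + fsmul phi f g'.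
Proof.
elim/fs_ind: f => [|i a|f f' IHf IHf'].
- by rewrite !fsmul0l addr0.
- by rewrite !fsmul_deltal fslinD// => j b b'; rewrite phiDr.
- by rewrite !fsmulDl IHf IHf' addrACA.
Qed.

Lemma fsmul0r f : fsmul phi f 0 = 0.
Proof. by apply: (addrI (fsmul phi f 0)); rewrite -fsmulDr !addr0. Qed.

Lemma fsmulZr c f g : fsmul phi f (c *: g) = c *: fsmul phi f g.
Proof.
elim/fs_ind: f => [|i a|f f' IHf IHf'].
- by rewrite !fsmul0l scaler0.
- rewrite !fsmul_deltal (@fslinZ _ _ id)// => j b b'; by rewrite phiDr.
- by rewrite !fsmulDl IHf IHf' scalerDr.
Qed.

Lemma fsmulZl c f g : fsmul phi (c *: f) g = c *: fsmul phi f g.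
Proof.
elim/fs_ind: g => [|i a|g g' IHg IHg'].
- by rewrite !fsmul0r scaler0.
- elim/fs_ind: f => [|j b|f f' IHf IHf'].
  + by rewrite scaler0 !fsmul0l scaler0.
  + by rewrite -linearZ/= !fsmul_delta.
  + by rewrite scalerDr !fsmulDl IHf IHf' scalerDr.
- by rewrite !fsmulDr IHg IHg' scalerDr.
Qed.

End FsMul.
End FinSupp.

Section StarAlgebras.
Variables (l : comPzRingType) (conj : {rmorphism l -> l}).

Record starAlg := StarAlg {
  sa_mod :> lmodType l;
  smul : sa_mod -> sa_mod -> sa_mod;
  star : sa_mod -> sa_mod;
  smulA : forall a b c, smul a (smul b c) = smul (smul a b) c;
  smulDl : forall a b c, smul (a + b) c = smul a c + smul b c;
  smulDr : forall a b c, smul a (b + c) = smul a b + smul a c;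
  smulZl : forall x a b, smul (x *: a) b = x *: smul a b;
  smulZr : forall x a b, smul a (x *: b) = x *: smul a b;
  starD : forall a b, star (a + b) = star a + star b;
  starK : forall a, star (star a) = a;
  starM : forall a b, star (smul a b) = smul (star b) (star a);
  starZ : forall x a, star (x *: a) = conj x *: star a
}.

Lemma smul0l (A : starAlg) (a : A) : smul 0 a = 0.
Proof. by rewrite -[X in smul X](scale0r (0 : A)) smulZl scale0r. Qed.
Lemma smul0r (A : starAlg) (a : A) : smul a 0 = 0.
Proof. by rewrite -[X in smul a X](scale0r (0 : A)) smulZr scale0r. Qed.
Lemma star0 (A : starAlg) : star (0 : A) = 0.
Proof. by rewrite -[X in star X](scale0r (0 : A)) starZ rmorph0 scale0r. Qed.

Definition unital (A : starAlg) : Prop :=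
  exists e : A, forall a, smul e a = a /\ smul a e = a.

Record starHom (A B : starAlg) := StarHom {
  sh_fun :> {linear A -> B};
  sh_mul : forall a b, sh_fun (smul a b) = smul (sh_fun a) (sh_fun b);
  sh_star : forall a, sh_fun (star a) = star (sh_fun a)
}.

Definition idh (A : starAlg) : starHom A A :=
  @StarHom A A idfun (fun _ _ => erefl) (fun _ => erefl).

Section CompHom.
Variables (A B C : starAlg) (g : starHom B C) (f : starHom A B).
Let gf : {linear A -> C} := (g \o f)%FUN.
Lemma comph_mul a b : gf (smul a b) = smul (gf a) (gf b).
Proof. by rewrite /= !sh_mul. Qed.
Lemma comph_star a : gf (star a) = star (gf a).
Proof. by rewrite /= !sh_star. Qed.
Definition comph : starHom A C := StarHom comph_mul comph_star.
End CompHom.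

(* The *-algebra A[t] with t^* = t; [delta i a] is a t^i.                     *)
Section Poly.
Variable A : starAlg.

Definition poly_phi (i j : nat) (a b : A) : fs nat A :=
  delta (i + j)%N (smul a b).
Definition poly_mul := fsmul poly_phi.
Definition poly_star := fslin (fun (i : nat) (a : A) => delta i (star a)).

Let pDl i j a a' b : poly_phi i j (a + a') b = poly_phi i j a b + poly_phi i j a' b.
Proof. by rewrite /poly_phi smulDl linearD. Qed.
Let pDr i j a b b' : poly_phi i j a (b + b') = poly_phi i j a b + poly_phi i j a b'.
Proof. by rewrite /poly_phi smulDr linearD. Qed.
Let pZl i j c a b : poly_phi i j (c *: a) b = c *: poly_phi i j a b.
Proof. by rewrite /poly_phi smulZl linearZ. Qed.
Let pZr i j c a b : poly_phi i j a (c *: b) = c *: poly_phi i j a b.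
Proof. by rewrite /poly_phi smulZr linearZ. Qed.
Let pMDl f f' g : poly_mul (f + f') g = poly_mul f g + poly_mul f' g.
Proof. exact: fsmulDl. Qed.
Let pMDr f g g' : poly_mul f (g + g') = poly_mul f g + poly_mul f g'.
Proof. exact: fsmulDr. Qed.
Let pM0l g : poly_mul 0 g = 0. Proof. exact: fsmul0l. Qed.
Let pM0r f : poly_mul f 0 = 0. Proof. exact: fsmul0r. Qed.
Let pS (i : nat) (a b : A) : delta i (star (a + b)) = delta i (star a) + delta i (star b).
Proof. by rewrite starD linearD. Qed.
Let pSZ (i : nat) c (a : A) : delta i (star (c *: a)) = conj c *: delta i (star a).
Proof. by rewrite starZ linearZ. Qed.

Lemma poly_mul_delta i j a b :
  poly_mul (delta i a) (delta j b) = delta (i + j)%N (smul a b).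
Proof. by rewrite /poly_mul fsmul_delta. Qed.

Lemma poly_star_delta i a : poly_star (delta i a) = delta i (star a).
Proof. by rewrite /poly_star fslin_delta. Qed.

Lemma poly_starD f g : poly_star (f + g) = poly_star f + poly_star g.
Proof. exact: fslinD. Qed.

Lemma poly_starZ c f : poly_star (c *: f) = conj c *: poly_star f.
Proof. exact: fslinZ. Qed.

Let pS0 : poly_star 0 = 0. Proof. exact: fslin0. Qed.

Lemma poly_mulA f g h : poly_mul f (poly_mul g h) = poly_mul (poly_mul f g) h.
Proof.
elim/fs_ind: f => [|i a|f f' IH IH'];
  last by rewrite !pMDl IH IH'.
  by rewrite !pM0l.
elim/fs_ind: g => [|j b|g g' IH IH'];
  last by rewrite !(pMDl, pMDr) IH IH'.
  by rewrite !(pM0l, pM0r).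
elim/fs_ind: h => [|k c|h h' IH IH'];
  last by rewrite !pMDr IH IH'.
  by rewrite !pM0r.
by rewrite !poly_mul_delta addnA smulA.
Qed.

Lemma poly_starK f : poly_star (poly_star f) = f.
Proof.
elim/fs_ind: f => [|i a|f f' IH IH'].
- by rewrite !pS0.
- by rewrite !poly_star_delta starK.
- by rewrite !poly_starD IH IH'.
Qed.

Lemma poly_starM f g :
  poly_star (poly_mul f g) = poly_mul (poly_star g) (poly_star f).
Proof.
elim/fs_ind: f => [|i a|f f' IH IH'].
- by rewrite pS0 pM0l pM0r pS0.
- elim/fs_ind: g => [|j b|g g' IH IH'].
  + by rewrite pS0 pM0l pM0r pS0.
  + by rewrite poly_mul_delta !poly_star_delta poly_mul_delta starM addnC.
  + by rewrite pMDr !poly_starD IH IH' pMDl.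
- by rewrite pMDl !poly_starD IH IH' pMDr.
Qed.

Definition polyAlg : starAlg :=
  StarAlg poly_mulA pMDl pMDr (fsmulZl pDl pDr pZl) (fsmulZr pDl pDr pZr)
    poly_starD poly_starK poly_starM poly_starZ.

Definition polyC_hom : starHom A polyAlg.
Proof.
apply: (@StarHom A polyAlg (delta 0%N)) => [a b|a] /=.
- by rewrite [RHS]poly_mul_delta.
- by rewrite [RHS]poly_star_delta.
Defined.
End Poly.

(* Finitely supported X x X matrices over A, with the involution              *)
(* x |-> h x^* h, where x^* is the conjugate transpose and h is the diagonal  *)
(* matrix with entries (-1)^(h x); [delta (x, y) a] is eps_{x,y} (x) a.       *)
Section Matrices.
Variables (X : choiceType) (h : X -> bool) (A : starAlg).

Definition mx_phi (p q : X * X) (a b : A) : fs (X * X)%type A :=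
  if p.2 == q.1 then delta (p.1, q.2) (smul a b) else 0.
Definition mx_psi (p : X * X) (a : A) : fs (X * X)%type A :=
  delta (p.2, p.1) (((-1) ^+ h p.2 * (-1) ^+ h p.1) *: star a).
Definition mx_mul := fsmul mx_phi.
Definition mx_star := fslin mx_psi.

Let pDl i j a a' b : mx_phi i j (a + a') b = mx_phi i j a b + mx_phi i j a' b.
Proof. by rewrite /mx_phi; case: eqP; rewrite ?addr0// smulDl linearD. Qed.
Let pDr i j a b b' : mx_phi i j a (b + b') = mx_phi i j a b + mx_phi i j a b'.
Proof. by rewrite /mx_phi; case: eqP; rewrite ?addr0// smulDr linearD. Qed.
Let pZl i j c a b : mx_phi i j (c *: a) b = c *: mx_phi i j a b.
Proof. by rewrite /mx_phi; case: eqP; rewrite ?scaler0// smulZl linearZ. Qed.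
Let pZr i j c a b : mx_phi i j a (c *: b) = c *: mx_phi i j a b.
Proof. by rewrite /mx_phi; case: eqP; rewrite ?scaler0// smulZr linearZ. Qed.
Let pMDl f f' g : mx_mul (f + f') g = mx_mul f g + mx_mul f' g.
Proof. exact: fsmulDl. Qed.
Let pMDr f g g' : mx_mul f (g + g') = mx_mul f g + mx_mul f g'.
Proof. exact: fsmulDr. Qed.
Let pM0l g : mx_mul 0 g = 0. Proof. exact: fsmul0l. Qed.
Let pM0r f : mx_mul f 0 = 0. Proof. exact: fsmul0r. Qed.
Let pS i (a b : A) : mx_psi i (a + b) = mx_psi i a + mx_psi i b.
Proof. by rewrite /mx_psi starD scalerDr linearD. Qed.
Let pSZ i c (a : A) : mx_psi i (c *: a) = conj c *: mx_psi i a.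
Proof.
by rewrite /mx_psi starZ scalerA [_ * conj c]mulrC -(scalerA (conj c)) linearZ.
Qed.

Lemma mx_mul_delta x y z w a b :
  mx_mul (delta (x, y) a) (delta (z, w) b) =
  if y == z then delta (x, w) (smul a b) else 0.
Proof. by rewrite /mx_mul fsmul_delta. Qed.

Lemma mx_star_delta x y a : mx_star (delta (x, y) a) =
  delta (y, x) (((-1) ^+ h y * (-1) ^+ h x) *: star a).
Proof. by rewrite /mx_star fslin_delta. Qed.

Lemma mx_starD f g : mx_star (f + g) = mx_star f + mx_star g.
Proof. exact: fslinD. Qed.

Lemma mx_starZ c f : mx_star (c *: f) = conj c *: mx_star f.
Proof. exact: fslinZ. Qed.

Let pS0 : mx_star 0 = 0. Proof. exact: fslin0. Qed.

Lemma mx_mulA f g k : mx_mul f (mx_mul g k) = mx_mul (mx_mul f g) k.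
Proof.
elim/fs_ind: f => [|[x y] a|f f' IH IH'];
  last by rewrite !pMDl IH IH'.
  by rewrite !pM0l.
elim/fs_ind: g => [|[z w] b|g g' IH IH'];
  last by rewrite !(pMDl, pMDr) IH IH'.
  by rewrite !(pM0l, pM0r).
elim/fs_ind: k => [|[u v] c|k k' IH IH'];
  last by rewrite !pMDr IH IH'.
  by rewrite !pM0r.
rewrite !mx_mul_delta.
have [->|wu] := eqVneq w u; have [->|yz] := eqVneq y z.
- by rewrite !mx_mul_delta !eqxx smulA.
- by rewrite pM0l mx_mul_delta (negPf yz).
- by rewrite pM0r mx_mul_delta (negPf wu).
- by rewrite pM0l pM0r.
Qed.

Lemma mx_starK f : mx_star (mx_star f) = f.
Proof.
elim/fs_ind: f => [|[x y] a|f f' IH IH'].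
- by rewrite !pS0.
- rewrite !mx_star_delta starZ scalerA starK rmorphM !rmorph_sign.
  by rewrite [X in X * _]mulrC mulrACA -!signr_addb !addbb scale1r.
- by rewrite !mx_starD IH IH'.
Qed.

Lemma mx_starM f g : mx_star (mx_mul f g) = mx_mul (mx_star g) (mx_star f).
Proof.
elim/fs_ind: f => [|[x y] a|f f' IH IH'].
- by rewrite pS0 pM0l pM0r pS0.
- elim/fs_ind: g => [|[z w] b|g g' IH IH'].
  + by rewrite pS0 pM0l pM0r pS0.
  + rewrite mx_mul_delta !mx_star_delta mx_mul_delta eq_sym.
    case: eqP => [->|_]; rewrite ?pS0// mx_star_delta starM smulZl smulZr scalerA.
    congr (delta _ (_ *: _)); rewrite -[RHS]mulrA; congr (_ * _).
    by rewrite mulrA -signr_addb addbb mul1r.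
  + by rewrite pMDr !mx_starD IH IH' pMDl.
- by rewrite pMDl !mx_starD IH IH' pMDr.
Qed.

Definition mxAlg : starAlg :=
  StarAlg mx_mulA pMDl pMDr (fsmulZl pDl pDr pZl) (fsmulZr pDl pDr pZr)
    mx_starD mx_starK mx_starM mx_starZ.

Definition corner_hom (x : X) : starHom A mxAlg.
Proof.
apply: (@StarHom A mxAlg (delta (x, x))) => [a b|a] /=.
- by rewrite [RHS]mx_mul_delta eqxx.
- by rewrite [RHS]mx_star_delta -signr_addb addbb expr0 scale1r.
Defined.
End Matrices.

(* For h = 0 all signs are 1 and the involution is the conjugate transpose.   *)
Definition matAlg (X : choiceType) (A : starAlg) : starAlg :=
  mxAlg (fun _ : X => false) A.
Definition mat_corner (X : choiceType) (x : X) (A : starAlg) :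
  starHom A (matAlg X A) := corner_hom _ A x.

(* 2 x 2 matrices are indexed by bool, false being the first index, so that   *)
(* h = diag(1, -1).                                                           *)
Definition pmAlg (A : starAlg) : starAlg := mxAlg (fun b : bool => b) A.
Definition pm_corner (A : starAlg) : starHom A (pmAlg A) :=
  corner_hom (fun b : bool => b) A false.

Section Graded.
Variable G : groupType.

Record grading (R : starAlg) := Grading {
  gpart : G -> set R;
  gpart0 : forall g, gpart g 0;
  gpartD : forall g a b, gpart g a -> gpart g b -> gpart g (a + b);
  gpartZ : forall g x a, gpart g a -> gpart g (x *: a);
  gpart_direct : forall a, exists! f : fs G R,
    (forall g, gpart g (f g)) /\ a = \sum_(g \in [set: G]) f g;
  gpartM : forall g h a b,
    gpart g a -> gpart h b -> gpart (g * h)%g (smul a b);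
  gpart_star : forall g a, gpart g a -> gpart (g^-1)%g (star a)
}.

(* R_g R_h is the additive span of the products ab.                           *)
Definition gpart_prod (R : starAlg) (gr : grading R) (g h : G) : set R :=
  [set c | exists2 s : seq (R * R),
    forall p, p \in s -> gpart gr g p.1 /\ gpart gr h p.2
    & c = \sum_(p <- s) smul p.1 p.2].

Definition strongly_graded (R : starAlg) (gr : grading R) : Prop :=
  forall g h, gpart_prod gr g h = gpart gr (g * h)%g.

Variables (R : starAlg) (gr : grading R).

(* [gcomps a g] is the component of a of degree g.                            *)
Definition gcomps (a : R) : fs G R := projT1 (cid (gpart_direct gr a)).

Lemma gcompsP a g : gpart gr g (gcomps a g).
Proof. by rewrite /gcomps; case: cid => f [[+ _] _] /=. Qed.

Lemma gcomps_sum a : a = \sum_(g \in [set: G]) gcomps a g.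
Proof. by case: (projT2 (cid (gpart_direct gr a))) => -[]. Qed.

Lemma gcomps_uniq a (f : fs G R) :
  (forall g, gpart gr g (f g)) -> a = \sum_(g \in [set: G]) f g -> gcomps a = f.
Proof.
by move=> hf af; rewrite /gcomps; case: cid => f' [_ uf] /=; exact: uf.
Qed.

Let sumE (f : fs G R) : \sum_(g \in [set: G]) f g = fslin (fun _ : G => idfun) f.
Proof. by []. Qed.

Lemma gcompsD a b : gcomps (a + b) = gcomps a + gcomps b.
Proof.
apply: gcomps_uniq => [g|].
  exact: gpartD (gcompsP a g) (gcompsP b g).
by rewrite sumE fslinD// -!sumE -!gcomps_sum.
Qed.

Lemma gcompsZ c a : gcomps (c *: a) = c *: gcomps a.
Proof.
apply: gcomps_uniq => [g|].
  exact: gpartZ (gcompsP a g).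
by rewrite sumE (@fslinZ _ _ _ _ _ id)// -!sumE -!gcomps_sum.
Qed.

Lemma gcomps_hom g a : gpart gr g a -> gcomps a = delta g a.
Proof.
move=> ga; apply: gcomps_uniq => [h|]; last by rewrite sumE fslin_delta.
by rewrite deltaE; case: eqP => [->//|_]; exact: gpart0.
Qed.

(* (chi_g b)(chi_h c) = delta_{h, g|b|} chi_g bc: for non-homogeneous b, only *)
(* its component of degree g^-1 h contributes.                                *)
Definition cp_phi (g h : G) (b c : R) : fs G R :=
  delta g (smul (gcomps b (g^-1 * h)%g) c).

(* (chi_g b)^* is the sum over s of chi_{gs} (b_s)^*.                         *)
Definition cp_psi (g : G) (b : R) : fs G R :=
  fslin (fun s bs => delta (g * s)%g (star bs)) (gcomps b).

Definition cp_mul := fsmul cp_phi.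
Definition cp_star := fslin cp_psi.

Let pDl i j a a' b : cp_phi i j (a + a') b = cp_phi i j a b + cp_phi i j a' b.
Proof. by rewrite /cp_phi gcompsD fsDE smulDl linearD. Qed.
Let pDr i j a b b' : cp_phi i j a (b + b') = cp_phi i j a b + cp_phi i j a b'.
Proof. by rewrite /cp_phi smulDr linearD. Qed.
Let pZl i j c a b : cp_phi i j (c *: a) b = c *: cp_phi i j a b.
Proof. by rewrite /cp_phi gcompsZ fsZE smulZl linearZ. Qed.
Let pZr i j c a b : cp_phi i j a (c *: b) = c *: cp_phi i j a b.
Proof. by rewrite /cp_phi smulZr linearZ. Qed.
Let pMDl f f' g : cp_mul (f + f') g = cp_mul f g + cp_mul f' g.
Proof. exact: fsmulDl. Qed.
Let pMDr f g g' : cp_mul f (g + g') = cp_mul f g + cp_mul f g'.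
Proof. exact: fsmulDr. Qed.
Let pM0l g : cp_mul 0 g = 0. Proof. exact: fsmul0l. Qed.
Let pM0r f : cp_mul f 0 = 0. Proof. exact: fsmul0r. Qed.
Let sD g (s : G) (a b : R) : delta (g * s)%g (star (a + b)) =
  delta (g * s)%g (star a) + delta (g * s)%g (star b).
Proof. by rewrite starD linearD. Qed.
Let pS i (a b : R) : cp_psi i (a + b) = cp_psi i a + cp_psi i b.
Proof. by rewrite /cp_psi gcompsD fslinD. Qed.
Let pSZ i c (a : R) : cp_psi i (c *: a) = conj c *: cp_psi i a.
Proof.
rewrite /cp_psi gcompsZ (@fslinZ _ _ _ _ _ conj)// => s x b.
by rewrite starZ linearZ.
Qed.

Lemma cp_mul_delta g h b c s : gpart gr s b ->
  cp_mul (delta g b) (delta h c) =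
  if h == (g * s)%g then delta g (smul b c) else 0.
Proof.
move=> sb; rewrite /cp_mul fsmul_delta// /cp_phi (gcomps_hom sb) deltaE.
rewrite (can2_eq (mulVKg g) (mulKg g)).
by case: eqP => // _; rewrite smul0l linear0.
Qed.

Lemma cp_star_delta g b s : gpart gr s b ->
  cp_star (delta g b) = delta (g * s)%g (star b).
Proof.
move=> sb; rewrite /cp_star fslin_delta// /cp_psi (gcomps_hom sb).
by rewrite fslin_delta.
Qed.

Lemma cp_starD f g : cp_star (f + g) = cp_star f + cp_star g.
Proof. exact: fslinD. Qed.

Lemma cp_starZ c f : cp_star (c *: f) = conj c *: cp_star f.
Proof. exact: fslinZ. Qed.

Let pS0 : cp_star 0 = 0. Proof. exact: fslin0. Qed.

Lemma cp_ind (P : fs G R -> Prop) : P 0 ->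
  (forall g s b, gpart gr s b -> P (delta g b)) ->
  (forall f g, P f -> P g -> P (f + g)) -> forall f, P f.
Proof.
move=> P0 Pd PD; apply: fs_ind => // g a; rewrite (gcomps_sum a).
elim/big_ind: _ => [|x y Px Py|s _]; rewrite ?linear0 ?linearD//; first exact: PD.
exact: Pd (gcompsP a s).
Qed.

Lemma cp_mulA f g k : cp_mul f (cp_mul g k) = cp_mul (cp_mul f g) k.
Proof.
elim/cp_ind: f => [|x s a sa|f f' IH IH'];
  last by rewrite !pMDl IH IH'.
  by rewrite !pM0l.
elim/cp_ind: g => [|y t b tb|g g' IH IH'];
  last by rewrite !(pMDl, pMDr) IH IH'.
  by rewrite !(pM0l, pM0r).
elim/cp_ind: k => [|z u c uc|k k' IH IH'];
  last by rewrite !pMDr IH IH'.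
  by rewrite !pM0r.
rewrite (cp_mul_delta _ _ _ tb) (cp_mul_delta _ _ _ sa).
have stab := gpartM sa tb.
case: (y =P _) => [->|yz]; last first.
  rewrite pM0l; case: eqP => _; rewrite ?pM0r// (cp_mul_delta _ _ _ sa).
  by case: eqP.
rewrite (cp_mul_delta _ _ _ stab) mulgA.
case: eqP => _; rewrite ?pM0r// (cp_mul_delta _ _ _ sa) eqxx smulA//.
Qed.

Lemma cp_starK f : cp_star (cp_star f) = f.
Proof.
elim/cp_ind: f => [|g s a sa|f f' IH IH'].
- by rewrite !pS0.
- rewrite (cp_star_delta _ sa) (cp_star_delta _ (gpart_star sa)) starK.
  by rewrite mulgK.
- by rewrite !cp_starD IH IH'.
Qed.

Lemma cp_starM f g : cp_star (cp_mul f g) = cp_mul (cp_star g) (cp_star f).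
Proof.
elim/cp_ind: f => [|x s a sa|f f' IH IH'].
- by rewrite pS0 pM0l pM0r pS0.
- elim/cp_ind: g => [|y t b tb|g g' IH IH'].
  + by rewrite pS0 pM0l pM0r pS0.
  + rewrite (cp_mul_delta _ _ _ sa) (cp_star_delta _ sa) (cp_star_delta _ tb).
    rewrite (cp_mul_delta _ _ _ (gpart_star tb)) mulgK eq_sym.
    case: eqP => [<-|_]; rewrite ?pS0//.
    by rewrite (cp_star_delta _ (gpartM sa tb)) starM mulgA.
  + by rewrite pMDr !cp_starD IH IH' pMDl.
- by rewrite pMDl !cp_starD IH IH' pMDr.
Qed.

Definition crossedProd : starAlg :=
  StarAlg cp_mulA pMDl pMDr (fsmulZl pDl pDr pZl) (fsmulZr pDl pDr pZr)
    cp_starD cp_starK cp_starM cp_starZ.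

Definition deg1_pred : {pred R} := fun a => `[< gpart gr 1%g a >].

Lemma deg1_submod : submod_closed deg1_pred.
Proof.
split=> [|c a b /asboolP ha /asboolP hb]; apply/asboolP; first exact: gpart0.
by apply: gpartD => //; exact: gpartZ.
Qed.
HB.instance Definition _ :=
  GRing.isSubmodClosed.Build l (sa_mod R) deg1_pred deg1_submod.

Record deg1 := Deg1 { deg1_val :> R; _ : deg1_val \in deg1_pred }.
HB.instance Definition _ := [isSub for deg1_val].
HB.instance Definition _ := [Choice of deg1 by <:].
HB.instance Definition _ := [SubChoice_isSubLmodule of deg1 by <:].

Lemma deg1P (a : deg1) : gpart gr 1%g (deg1_val a).
Proof. by case: a => a /= /asboolP. Qed.

Lemma deg1_mul_subproof (a b : deg1) :
  smul (deg1_val a) (deg1_val b) \in deg1_pred.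
Proof.
by apply/asboolP; rewrite -[1%g]mulg1; apply: gpartM; exact: deg1P.
Qed.
Lemma deg1_star_subproof (a : deg1) : star (deg1_val a) \in deg1_pred.
Proof.
by apply/asboolP; rewrite -[1%g]invg1; apply: gpart_star; exact: deg1P.
Qed.
Definition deg1_mul (a b : deg1) : deg1 := Deg1 (deg1_mul_subproof a b).
Definition deg1_star (a : deg1) : deg1 := Deg1 (deg1_star_subproof a).

Definition deg1Alg : starAlg.
Proof.
apply: (@StarAlg deg1 deg1_mul deg1_star) => *; apply: val_inj => /=.
- exact: smulA.
- exact: smulDl.
- exact: smulDr.
- exact: smulZl.
- exact: smulZr.
- exact: starD.
- exact: starK.
- exact: starM.
- exact: starZ.
Defined.

Definition deg1_incl (a : deg1Alg) : crossedProd := delta 1%g (deg1_val a).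

Lemma deg1_incl_linear : linear deg1_incl.
Proof. by move=> c a b; rewrite /deg1_incl -linearP. Qed.
HB.instance Definition _ :=
  GRing.isLinear.Build l deg1Alg crossedProd _ deg1_incl deg1_incl_linear.

Definition deg1_hom : starHom deg1Alg crossedProd.
Proof.
apply: (@StarHom deg1Alg crossedProd deg1_incl) => [a b|a].
- by rewrite [RHS](cp_mul_delta _ _ _ (deg1P a)) mulg1 eqxx.
- by rewrite [RHS](cp_star_delta _ (deg1P a)) mulg1.
Defined.
End Graded.

(* Surjectivity of B -> C is implied by the existence of a section; the       *)
(* section is not part of the data.                                           *)
Record extension := Extension {
  extA : starAlg;
  extB : starAlg;
  extC : starAlg;
  ext_i : starHom extA extB;
  ext_p : starHom extB extC;
  ext_inj : injective ext_i;
  ext_exact : forall b, ext_p b = 0 <-> exists a, ext_i a = b;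
  ext_split : exists s : {linear extC -> extB}, forall c, ext_p (s c) = c
}.

Record extMor (E E' : extension) := ExtMor {
  emA : starHom (extA E) (extA E');
  emB : starHom (extB E) (extB E');
  emC : starHom (extC E) (extC E');
  em_i : forall a, emB (ext_i E a) = ext_i E' (emA a);
  em_p : forall b, emC (ext_p E b) = ext_p E' (emB b)
}.

End StarAlgebras.

Record addCat (Ob : Type) := AddCat {
  hom :> Ob -> Ob -> zmodType;
  idc : forall X, hom X X;
  cmp : forall X Y Z, hom Y Z -> hom X Y -> hom X Z;
  cmp1l : forall X Y (f : hom X Y), cmp (idc Y) f = f;
  cmp1r : forall X Y (f : hom X Y), cmp f (idc X) = f;
  cmpA : forall X Y Z W (f : hom Z W) (g : hom Y Z) (h : hom X Y),
    cmp f (cmp g h) = cmp (cmp f g) h;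
  cmpDl : forall X Y Z (f f' : hom Y Z) (g : hom X Y),
    cmp (f + f') g = cmp f g + cmp f' g;
  cmpDr : forall X Y Z (f : hom Y Z) (g g' : hom X Y),
    cmp f (g + g') = cmp f g + cmp f g';
  zero_ob : exists Z, idc Z = 0;
  biprod : forall X Y, exists S (i1 : hom X S) (i2 : hom Y S)
      (p1 : hom S X) (p2 : hom S Y),
    [/\ cmp p1 i1 = idc X, cmp p2 i2 = idc Y, cmp p2 i1 = 0, cmp p1 i2 = 0
      & cmp i1 p1 + cmp i2 p2 = idc S]
}.

Arguments idc {Ob a} X.
Arguments cmp {Ob a X Y Z}.
Declare Scope cat_scope.
Notation "g \oc f" := (cmp g f) (at level 50, left associativity) : cat_scope.
Local Open Scope cat_scope.

Definition is_inverse Ob (T : addCat Ob) X Y (f : T X Y) (g : T Y X) : Prop :=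
  g \oc f = idc X /\ f \oc g = idc Y.
Definition is_iso Ob (T : addCat Ob) X Y (f : T X Y) : Prop :=
  exists g : T Y X, is_inverse f g.

(* Triangulated categories, in terms of the inverse suspension Omega (an      *)
(* autoequivalence, not necessarily bijective on objects): a triangle is a    *)
(* sequence Omega C -> A -> B -> C. The axioms are those of Verdier for the   *)
(* opposite category, with suspension Omega.                                  *)
Record triCat (Ob : Type) := TriCat {
  tcat :> addCat Ob;
  Om0 : Ob -> Ob;
  Om : forall X Y, tcat X Y -> tcat (Om0 X) (Om0 Y);
  Om1 : forall X, Om (idc X) = idc (Om0 X);
  OmM : forall X Y Z (g : tcat Y Z) (f : tcat X Y), Om (g \oc f) = Om g \oc Om f;
  OmD : forall X Y (f g : tcat X Y), Om (f + g) = Om f + Om g;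
  Om_ff : forall X Y, bijective (@Om X Y);
  Om_esssurj : forall X, exists Y (f : tcat (Om0 Y) X), is_iso f;

  dist : forall A B C, tcat (Om0 C) A -> tcat A B -> tcat B C -> Prop;

  dist_iso : forall A B C A' B' C'
      (al : tcat (Om0 C) A) (be : tcat A B) (ga : tcat B C)
      (al' : tcat (Om0 C') A') (be' : tcat A' B') (ga' : tcat B' C')
      (a : tcat A A') (b : tcat B B') (c : tcat C C'),
    is_iso a -> is_iso b -> is_iso c ->
    a \oc al = al' \oc Om c -> b \oc be = be' \oc a -> c \oc ga = ga' \oc b ->
    dist al be ga -> dist al' be' ga';
  dist_id : forall Z C, idc Z = 0 :> tcat Z Z ->
    dist (0 : tcat (Om0 C) Z) (0 : tcat Z C) (idc C);
  dist_complete : forall B C (ga : tcat B C), exists A (al : tcat (Om0 C) A)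
    (be : tcat A B), dist al be ga;
  dist_rot : forall A B C
      (al : tcat (Om0 C) A) (be : tcat A B) (ga : tcat B C),
    dist al be ga <-> dist (- Om ga) al be;
  dist_fill : forall A B C A' B' C'
      (al : tcat (Om0 C) A) (be : tcat A B) (ga : tcat B C)
      (al' : tcat (Om0 C') A') (be' : tcat A' B') (ga' : tcat B' C')
      (b : tcat B B') (c : tcat C C'),
    dist al be ga -> dist al' be' ga' -> c \oc ga = ga' \oc b ->
    exists a : tcat A A', a \oc al = al' \oc Om c /\ b \oc be = be' \oc a;
  (* octahedral axiom: for f : X -> Y and g : Y -> Z, there is a triangle     *)
  (* Omega (fib g) -> fib f -> fib (g f) -> fib g                             *)
  dist_oct : forall X Y Z (f : tcat X Y) (g : tcat Y Z)
      Ff (jf : tcat (Om0 Y) Ff) (pf : tcat Ff X)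
      Fg (jg : tcat (Om0 Z) Fg) (pg : tcat Fg Y)
      Fgf (jgf : tcat (Om0 Z) Fgf) (pgf : tcat Fgf X),
    dist jf pf f -> dist jg pg g -> dist jgf pgf (g \oc f) ->
    exists (u : tcat Ff Fgf) (v : tcat Fgf Fg),
      dist (jf \oc Om pg) u v /\
      [/\ pgf \oc u = pf, pg \oc v = f \oc pgf,
          v \oc jgf = jg & u \oc jf = jgf \oc Om g]
}.

Section HomologyTheories.
Variables (l : comPzRingType) (conj : {rmorphism l -> l}).
Local Notation starAlg := (starAlg conj).

(* The object map H0 is a parameter, so that a theory which is the identity   *)
(* on objects is one with T : triCat starAlg and H0 = fun A => A.             *)
Record excisiveTheory Ob (T : triCat Ob) (H0 : starAlg -> Ob) := ExcisiveTheory {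
  hmap :> forall A B : starAlg, starHom A B -> T (H0 A) (H0 B);
  hmap1 : forall A, hmap (idh A) = idc (H0 A);
  hmapM : forall A B C (g : starHom B C) (f : starHom A B),
    hmap (comph g f) = hmap g \oc hmap f;
  bdry : forall E : extension conj, T (Om0 T (H0 (extC E))) (H0 (extA E));
  bdry_nat : forall E E' (m : extMor E E'),
    hmap (emA m) \oc bdry E = bdry E' \oc Om (hmap (emC m));
  bdry_dist : forall E, dist (bdry E) (hmap (ext_i E)) (hmap (ext_p E))
}.

Section Stability.
Variables (Ob : Type) (T : triCat Ob) (H0 : starAlg -> Ob).
Variable H : excisiveTheory T H0.

Definition homotopy_invariant : Prop :=
  forall A, is_iso (H _ _ (polyC_hom A)).

Definition mat_stable (X : choiceType) : Prop :=
  forall (A : starAlg) (x : X), is_iso (H _ _ (mat_corner x A)).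

Definition iota_stable : Prop :=
  forall A, is_iso (H _ _ (pm_corner A)).

Definition hermitian_theory (X : choiceType) : Prop :=
  [/\ homotopy_invariant, mat_stable X & iota_stable].
End Stability.

(* Morphisms to a theory H from a theory j which is the identity on objects:  *)
(* triangulated functors F from kk to T with F o j = H, together with the     *)
(* natural isomorphism F Omega -> Omega F, compatible with boundary maps. The *)
(* object map of F is that of H.                                              *)
Record theoryMor (kk : triCat starAlg) (j : excisiveTheory kk (fun A => A))
    Ob (T : triCat Ob) (H0 : starAlg -> Ob) (H : excisiveTheory T H0) :=
  TheoryMor {
  tmap : forall A B : starAlg, kk A B -> T (H0 A) (H0 B);
  tmap1 : forall A, tmap (idc A) = idc (H0 A);
  tmapM : forall A B C (g : kk B C) (f : kk A B),
    tmap (g \oc f) = tmap g \oc tmap f;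
  tmapD : forall A B (f g : kk A B), tmap (f + g) = tmap f + tmap g;
  tOm : forall A, T (H0 (Om0 kk A)) (Om0 T (H0 A));
  tOm_nat : forall A B (f : kk A B), Om (tmap f) \oc tOm A = tOm B \oc tmap (Om f);
  tOm_iso : forall A, is_iso (tOm A);
  tmap_dist : forall A B C
      (al : kk (Om0 kk C) A) (be : kk A B) (ga : kk B C)
      (al' : T (Om0 T (H0 C)) (H0 A)),
    dist al be ga -> al' \oc tOm C = tmap al -> dist al' (tmap be) (tmap ga);
  tmap_j : forall A B (f : starHom A B), tmap (j A B f) = H A B f;
  tmap_bdry : forall E : extension conj,
    tmap (bdry j E) = bdry H E \oc tOm (extC E)
}.

(* [is_jh X j]: (kk, j) is the initial homotopy invariant, M_X-stable,        *)
(* iota_+-stable excisive homology theory, i.e. j is j^h and kk is kk^h.      *)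
Definition is_jh (X : choiceType) (kk : triCat starAlg)
    (j : excisiveTheory kk (fun A => A)) : Prop :=
  hermitian_theory j X /\
  forall Ob (T : triCat Ob) (H0 : starAlg -> Ob) (H : excisiveTheory T H0),
    hermitian_theory H X -> exists F : theoryMor j H, forall F', F' = F.

End HomologyTheories.

(* Main.v *)
From HB Require Import structures.
Require Import Defs.
From mathcomp Require Import all_boot monoid all_order all_algebra.
From mathcomp Require Import finmap all_classical.

Set Implicit Arguments.
Unset Strict Implicit.
Unset Printing Implicit Defensive.

Import GRing.Theory.
Local Open Scope ring_scope.
Local Open Scope cat_scope.

(** Write [C] for the crossed product, [iota : R_1 -> C] for the inclusion and
    [M_J] for matrices indexed by [J] with an involution twisted by signs
    [eps_j].  The algebra [C] consists of the finitely supported matrices over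
    [G x G] whose entry [(g, h)] lies in [R_(g^-1 h)], and [R_1] is its corner
    at [chi_1].  Strong grading makes this corner full, and the proof is a
    hermitian form of Morita invariance that uses matrix stability alone,
    without homotopies or excision.

    The input from the grading is a signed partition of unity
    ([signed_partition_of_unity]): for each [g] there are finitely many [z_i]
    in [R_(g^-1)] with [sum_i eps_i z_i z_i^* = 1].  Indeed [1] is a sum of
    products [u v^*] with [u, v] in [R_(g^-1)]; as [lambda + lambda^* = 1], it
    is also a sum of terms [u v^* + v u^*], and the hyperbolic form that appears
    there is diagonalized with signs [1, -1] by means of [lambda]
    ([hyperbolic_split]).

    Let [J] index all the [z_i] for all [g].  Then
    [psi(c)_ij = eps_j w_i^* c w_j], with [w_i = chi_g z_i], is a *-homomorphism
    [C -> M_J C], because [sum_j eps_j w_j w_j^*] acts as the identity.  Its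
    entries lie in [iota R_1], so [psi = M_J(iota) phi] for some
    [phi : C -> M_J R_1]; choosing the partition [1 = 1 1^*] for [g = 1] makes
    [phi iota] a corner inclusion, whose image under [j] is invertible.  By the
    two-out-of-six property ([is_iso_2of6]) it remains to see that [j(psi)] is
    invertible.

    For this, [psi] is extended to a *-homomorphism [Theta : M_X C -> M_J C]
    whose composite with the corner inclusion at [x0] is [psi], and whose
    composite with the corner inclusion at every other [x] is again a corner
    inclusion.  Since [j] inverts these corner inclusions, the second property
    shows that [j(Theta)] is invertible, and then so is [j(psi)].

    The index set is [J = X * X * bool], with the sign in the last coordinate:
    this needs only an injection of [G + nat] into [X], and the corner
    inclusions into [M_J] at indices of positive sign are inverted because
    [M_J] is [M_X M_X M_pm]. *)

(** * Isomorphisms in a category *)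

Section Isomorphisms.
Variables (Ob : Type) (T : addCat Ob).

Lemma is_iso_comp X Y Z (g : T Y Z) (f : T X Y) :
  is_iso g -> is_iso f -> is_iso (g \oc f).
Proof.
move=> [g' [g'g gg']] [f' [f'f ff']]; exists (f' \oc g'); split.
- by rewrite -cmpA [g' \oc _]cmpA g'g cmp1l.
- by rewrite -cmpA [f \oc _]cmpA ff' cmp1l.
Qed.

Lemma is_iso_cancelr X Y Z (g : T Y Z) (f : T X Y) :
  is_iso f -> is_iso (g \oc f) -> is_iso g.
Proof.
move=> fi [k [kgf gfk]].
case: (fi) => f' [f'f ff'].
have -> : g = (g \oc f) \oc f' by rewrite -cmpA ff' cmp1r.
by apply: is_iso_comp; [exists k|exists f].
Qed.

Lemma is_iso_cancell X Y Z (g : T Y Z) (f : T X Y) :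
  is_iso g -> is_iso (g \oc f) -> is_iso f.
Proof.
move=> gi gfi; case: (gi) => g' [g'g gg'].
have -> : f = g' \oc (g \oc f) by rewrite cmpA g'g cmp1l.
by apply: is_iso_comp => //; exists g.
Qed.

(** [g] is split monic by the second hypothesis and split epic by the first. *)
Lemma is_iso_2of6 X Y Z W (h : T Z W) (g : T Y Z) (f : T X Y) :
  is_iso (g \oc f) -> is_iso (h \oc g) -> is_iso f.
Proof.
move=> [k [kgf gfk]] [k' [k'hg hgk']]; exists (k \oc g); split.
  by rewrite -cmpA.
(* g is monic because it has the left inverse k' h *)
rewrite -[LHS]cmp1l -k'hg -!cmpA.
rewrite [g \oc (f \oc _)]cmpA [(g \oc f) \oc _]cmpA gfk cmp1l.
by rewrite !cmpA.
Qed.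

End Isomorphisms.

(** * Star-algebras and homomorphisms *)

Section StarAlgebraLemmas.
Variables (l : comPzRingType) (conj : {rmorphism l -> l}).
Local Notation starAlg := (starAlg conj).
Implicit Types A B C : starAlg.

Lemma smul_suml A (I : Type) (r : seq I) (P : pred I) (F : I -> A) (b : A) :
  smul (\sum_(i <- r | P i) F i) b = \sum_(i <- r | P i) smul (F i) b.
Proof.
elim/big_rec2: _ => [|i x y _ <-]; first exact: smul0l.
by rewrite smulDl.
Qed.

Lemma smul_sumr A (I : Type) (r : seq I) (P : pred I) (F : I -> A) (b : A) :
  smul b (\sum_(i <- r | P i) F i) = \sum_(i <- r | P i) smul b (F i).
Proof.
elim/big_rec2: _ => [|i x y _ <-]; first exact: smul0r.
by rewrite smulDr.
Qed.

Lemma star_signZ A (n : nat) (a : A) : star ((-1) ^+ n *: a) = (-1) ^+ n *: star a.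
Proof. by rewrite starZ rmorph_sign. Qed.

Lemma starHom_eq A B (f g : starHom A B) : (forall a, f a = g a) -> f = g.
Proof.
case: f g => -[f [[f1] [f2]]] fM fS [[g [[g1] [g2]]] gM gS] /= fg.
have {}fg : f = g by apply/funext.
subst g; have ? := Prop_irrelevance f1 g1; have ? := Prop_irrelevance f2 g2.
by subst g1 g2; congr StarHom; exact: Prop_irrelevance.
Qed.

(** Linearity and compatibility with the structure are inherited by any
    set-theoretic factorization through an injective *-homomorphism. *)
Lemma starHom_factor A B C (f : starHom A C) (i : starHom B C) :
  injective i -> (forall a, exists b, i b = f a) ->
  exists g : starHom A B, comph i g = f.
Proof.
move=> i_inj /choice[g gE].
have g_lin : linear g.
  by move=> c a b; apply: i_inj; rewrite linearP !gE linearP.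
pose gL : {linear A -> B} := HB.pack g (GRing.isLinear.Build l A B _ g g_lin).
have gM a b : gL (smul a b) = smul (gL a) (gL b).
  by apply: i_inj; rewrite sh_mul !gE sh_mul.
have gS a : gL (star a) = star (gL a).
  by apply: i_inj; rewrite sh_star !gE sh_star.
by exists (StarHom gM gS); apply: starHom_eq => a /=; rewrite gE.
Qed.

Section Functor.
Variables (Ob : Type) (T : triCat Ob) (H0 : starAlg -> Ob).
Variable H : excisiveTheory T H0.

Lemma bij_starHom_iso A B (f : starHom A B) :
  injective f -> (forall b, exists a, f a = b) -> is_iso (H A B f).
Proof.
move=> f_inj f_surj.
have [g fg] := starHom_factor (f := idh B) f_inj f_surj.
exists (H _ _ g); split; rewrite -(hmapM H); last by rewrite fg (hmap1 H).
rewrite -(hmap1 H); congr (H _ _ _); apply: starHom_eq => a; apply: f_inj.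
by rewrite -[LHS]/(comph f g (f a)) fg.
Qed.

End Functor.

(** * Matrix algebras, entrywise *)

Section MatrixEntries.
Variables (J : choiceType) (h : J -> bool) (A : starAlg).
Implicit Types m n : mxAlg h A.

Definition entry m (i j : J) : A := fs_val m (i, j).

Lemma mxalgP m n : (forall i j, entry m i j = entry n i j) -> m = n.
Proof. by move=> mn; apply: fsP => -[i j]; exact: mn. Qed.

Lemma entryD m n i j : entry (m + n) i j = entry m i j + entry n i j.
Proof. by []. Qed.

Lemma entry_delta x y a i j :
  entry (delta (x, y) a) i j = if (i == x) && (j == y) then a else 0.
Proof. by rewrite /entry deltaE xpair_eqE. Qed.

Lemma mxalg_ind (P : mxAlg h A -> Prop) : P 0 ->
  (forall x y a, P (delta (x, y) a)) -> (forall m n, P m -> P n -> P (m + n)) ->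
  forall m, P m.
Proof. by move=> P0 Pd PD; apply: fs_ind => // -[x y] a. Qed.

Lemma entry_star m i j :
  entry (star m) i j = ((-1) ^+ h i * (-1) ^+ h j) *: star (entry m j i).
Proof.
elim/mxalg_ind: m => [|x y a|m n IHm IHn].
- by rewrite star0 /entry star0 scaler0.
- rewrite [star _]mx_star_delta !entry_delta [(j == x) && _]andbC.
  have [->|_] := eqVneq i y; last by rewrite /= star0 scaler0.
  have [->|_] := eqVneq j x; last by rewrite /= star0 scaler0.
  by [].
- by rewrite starD !entryD IHm IHn starD scalerDr.
Qed.

(** The sum ranges over any finite [F] outside which the terms vanish, so that
    [F] can be adapted to one factor only. *)
Lemma entry_mul m n i k (F : {fset J}) :
  (forall j, j \notin F -> smul (entry m i j) (entry n j k) = 0) ->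
  entry (smul m n) i k = \sum_(j <- F) smul (entry m i j) (entry n j k).
Proof.
have [E mulE] : exists E : {fset J}, forall E' : {fset J}, (E `<=` E')%fset ->
    entry (smul m n) i k = \sum_(j <- E') smul (entry m i j) (entry n j k).
  elim/mxalg_ind: m => [|x y a|m m' [E IH] [E' IH']].
  - exists fset0 => E _; rewrite big1 ?smul0l// => j _.
    by rewrite /entry smul0l.
  - exists [fset y]%fset => E yE; rewrite -(big_fset_incl _ yE); last first.
      by move=> j _; rewrite inE entry_delta => /negPf->; rewrite andbF smul0l.
    rewrite big_seq_fset1 entry_delta eqxx andbT.
    elim/mxalg_ind: n => [|z w b|n n' IHn IHn'].
    + by rewrite smul0r [RHS]smul0r.
    + rewrite [smul _ _]mx_mul_delta entry_delta.
      have [_|_] := eqVneq y z; last by rewrite /= smul0r.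
      rewrite entry_delta; have [_|_] := eqVneq i x => /=; last by rewrite smul0l.
      by case: eqP => // _; rewrite smul0r.
    + by rewrite smulDr !entryD IHn IHn' smulDr.
  - exists (E `|` E')%fset => E''; rewrite fsubUset => /andP[EE'' E'E''].
    rewrite smulDl entryD (IH _ EE'') (IH' _ E'E'') -big_split.
    by apply: eq_bigr => j _; rewrite entryD smulDl.
move=> F0; rewrite (mulE (E `|` F)%fset (fsubsetUl _ _)); apply/esym.
by apply: big_fset_incl => [|j _ /F0//]; exact: fsubsetUr.
Qed.

Lemma mx_smul_delta x y z w a b :
  (smul (delta (x, y) a : mxAlg h A) (delta (z, w) b : mxAlg h A) =
  if y == z then delta (x, w) (smul a b) else 0).
Proof. exact: mx_mul_delta. Qed.

End MatrixEntries.

Section MatrixFunctoriality.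
Variables (J : choiceType) (h : J -> bool) (A B : starAlg) (f : starHom A B).

Lemma mx_map_subproof (m : mxAlg h A) :
  (fun p => f (fs_val m p)) \in @fs_pred l (J * J)%type B.
Proof.
apply/asboolP; apply: sub_finite_set (fs_fin m) => p /=.
by move=> fm m0; apply: fm; rewrite m0 linear0.
Qed.
Definition mx_map (m : mxAlg h A) : mxAlg h B := Fs (mx_map_subproof m).

Lemma entry_mx_map m i j : entry (mx_map m) i j = f (entry m i j).
Proof. by []. Qed.

Lemma mx_map_linear : linear mx_map.
Proof. by move=> c m n; apply: mxalgP => i j; exact: linearP. Qed.
HB.instance Definition _ :=
  GRing.isLinear.Build l (mxAlg h A) (mxAlg h B) _ mx_map mx_map_linear.

Lemma mx_map_delta p a : mx_map (delta p a) = delta p (f a).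
Proof.
apply: fsP => q; rewrite [LHS]/= !deltaE; by case: eqP => // _; rewrite linear0.
Qed.

Lemma mx_mapD m n : mx_map (m + n) = mx_map m + mx_map n.
Proof. exact: linearD. Qed.

Lemma mx_mapM m n : mx_map (smul m n) = smul (mx_map m) (mx_map n).
Proof.
elim/mxalg_ind: m => [|x y a|m m' IH IH'].
- by rewrite smul0l linear0 smul0l.
- elim/mxalg_ind: n => [|z w b|n n' IH IH'].
  + by rewrite smul0r linear0 smul0r.
  + rewrite !mx_map_delta !mx_smul_delta.
    by case: eqP => _; rewrite ?linear0//= mx_map_delta sh_mul.
  + by rewrite smulDr !mx_mapD smulDr IH IH'.
- by rewrite smulDl !mx_mapD smulDl IH IH'.
Qed.

Lemma mx_map_star m : mx_map (star m) = star (mx_map m).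
Proof.
apply: mxalgP => i j.
by rewrite entry_star !entry_mx_map entry_star linearZ sh_star.
Qed.

Definition mx_hom : starHom (mxAlg h A) (mxAlg h B) :=
  @StarHom _ _ (mxAlg h A) (mxAlg h B) mx_map mx_mapM mx_map_star.

End MatrixFunctoriality.
End StarAlgebraLemmas.

Arguments entry : simpl never.

Section Stability.
Variables (l : comPzRingType) (conj : {rmorphism l -> l}).
Local Notation starAlg := (starAlg conj).

(** * Stability under iterated matrices *)

Section IteratedMatrices.
Variables (Y Z : choiceType) (hY : Y -> bool) (hZ : Z -> bool) (A : starAlg).
Local Notation h := (fun v : Y * Z => hY v.1 (+) hZ v.2).
Implicit Types m n : mxAlg h A.

Definition nest_delta (p : (Y * Z) * (Y * Z)) (a : A) :
    mxAlg hY (mxAlg hZ A) :=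
  delta (p.1.1, p.2.1) (delta (p.1.2, p.2.2) a : mxAlg hZ A).
Definition nest (m : mxAlg h A) : mxAlg hY (mxAlg hZ A) := fslin nest_delta m.

Let nest_deltaD p a b : nest_delta p (a + b) = nest_delta p a + nest_delta p b.
Proof. by rewrite /nest_delta !linearD. Qed.
Let nest_deltaZ p c a : nest_delta p (c *: a) = c *: nest_delta p a.
Proof. by rewrite /nest_delta !linearZ. Qed.

Lemma nestD m n : nest (m + n) = nest m + nest n.
Proof. exact: fslinD. Qed.

Lemma nest0 : nest 0 = 0.
Proof. exact: fslin0. Qed.

Lemma nest_linear : linear nest.
Proof. by move=> c m n; rewrite nestD /nest (@fslinZ _ _ _ _ _ id). Qed.
HB.instance Definition _ := GRing.isLinear.Build l (mxAlg h A)
  (mxAlg hY (mxAlg hZ A)) _ nest nest_linear.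

Lemma nestE y z y' z' a : nest (delta ((y, z), (y', z')) a) =
  delta (y, y') (delta (z, z') a : mxAlg hZ A).
Proof. by rewrite /nest fslin_delta. Qed.

Lemma entry_nest m y y' z z' :
  entry (entry (nest m) y y') z z' = entry m (y, z) (y', z').
Proof.
elim/mxalg_ind: m => [|[y1 z1] [y2 z2] a|m n IHm IHn].
- by rewrite nest0.
- rewrite nestE !entry_delta !xpair_eqE.
  have [_|_] := eqVneq y y1; have [_|_] := eqVneq y' y2 => //=.
  by rewrite andbF.
- by rewrite nestD !entryD IHm IHn.
Qed.

Lemma nestM m n : nest (smul m n) = smul (nest m) (nest n).
Proof.
elim/mxalg_ind: m => [|[y1 z1] [y2 z2] a|m m' IH IH'].
- by rewrite smul0l nest0 smul0l.
- elim/mxalg_ind: n => [|[y3 z3] [y4 z4] b|n n' IH IH'].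
  + by rewrite smul0r nest0 smul0r.
  + rewrite mx_smul_delta !nestE mx_smul_delta xpair_eqE.
    case: eqP => _; last exact: nest0.
    rewrite andTb mx_smul_delta; case: eqP => _; first by rewrite nestE.
    by rewrite nest0 linear0.
  + by rewrite smulDr !nestD smulDr IH IH'.
- by rewrite smulDl !nestD smulDl IH IH'.
Qed.

Lemma nest_star m : nest (star m) = star (nest m).
Proof.
apply: mxalgP => y y'; apply: mxalgP => z z'.
rewrite entry_nest entry_star entry_star.
rewrite [RHS](_ : _ = ((-1) ^+ hY y * (-1) ^+ hY y') *:
  entry (star (entry (nest m) y' y)) z z')//.
by rewrite entry_star entry_nest scalerA /= !signr_addb mulrACA.
Qed.

Definition nest_hom : starHom (mxAlg h A) (mxAlg hY (mxAlg hZ A)) :=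
  @StarHom _ _ (mxAlg h A) (mxAlg hY (mxAlg hZ A)) nest nestM nest_star.

Lemma nest_inj : injective nest_hom.
Proof.
move=> m n mn; apply: mxalgP => -[y z] [y' z'].
by rewrite -!entry_nest -[nest m]/(nest_hom m) mn.
Qed.

Lemma nest_surj (n : mxAlg hY (mxAlg hZ A)) : exists m, nest_hom m = n.
Proof.
elim/mxalg_ind: n => [|y y' c|n n' [m mn] [m' mn']].
- by exists 0; exact: nest0.
- elim/mxalg_ind: c => [|z z' a|c c' [m mn] [m' mn']].
  + by exists 0; rewrite !linear0.
  + by exists (delta ((y, z), (y', z')) a); exact: nestE.
  + by exists (m + m'); rewrite !linearD mn mn'.
- by exists (m + m'); rewrite -mn -mn'; exact: nestD.
Qed.

End IteratedMatrices.

Lemma mx_hom_inj (J : choiceType) (h : J -> bool) (A B : starAlg)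
  (f : starHom A B) : injective f -> injective (mx_hom h f).
Proof.
move=> f_inj m n mn; apply: mxalgP => i j; apply: f_inj.
by rewrite -2!(entry_mx_map (h := h)) -[mx_map f m]/(mx_hom h f m) mn.
Qed.

Lemma mx_hom_range (J : choiceType) (h : J -> bool) (A B : starAlg)
    (f : starHom A B) (m : mxAlg h B) :
  (forall i j, exists a, f a = entry m i j) -> exists n, mx_hom h f n = m.
Proof.
move=> fm; rewrite [m]fs_expand; elim/big_ind: _ => [|x y [n <-] [n' <-]|[i j] _].
- by exists 0; rewrite linear0.
- by exists (n + n'); rewrite linearD.
- have [a fa] := fm i j; exists (delta (i, j) a).
  by rewrite /= mx_map_delta fa.
Qed.

(** * Corner inclusions *)

Section Corners.
Variables (Ob : Type) (T : triCat Ob) (H0 : starAlg -> Ob).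
Variable H : excisiveTheory T H0.

Lemma corner_natural (J : choiceType) (h : J -> bool) (A B : starAlg)
    (f : starHom A B) x :
  comph (mx_hom h f) (corner_hom h A x) = comph (corner_hom h B x) f.
Proof. by apply: starHom_eq => a; exact: mx_map_delta. Qed.

Definition corners_inverted (J : choiceType) (h : J -> bool) : Prop :=
  forall A x, h x = false -> is_iso (H _ _ (corner_hom h A x)).

(** Through the isomorphism of [M_(Y x Z) A] with [M_Y (M_Z A)], the corner at
    [(y0, z)] is the corner at [y0] of the corner at [z]. *)
Lemma corners_inverted_prod (Y Z : choiceType) (hY : Y -> bool) (hZ : Z -> bool) y0 :
  corners_inverted hY -> corners_inverted hZ -> hY y0 = false ->
  forall A z, hZ z = false ->
  is_iso (H _ _ (corner_hom (fun v : Y * Z => hY v.1 (+) hZ v.2) A (y0, z))).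
Proof.
move=> HY HZ hy0 A z hz.
have nest_iso := bij_starHom_iso H (@nest_inj Y Z hY hZ A) (@nest_surj Y Z hY hZ A).
apply/(@is_iso_cancell _ _ _ _ _ (H _ _ (nest_hom hY hZ A)) _ nest_iso).
rewrite -(hmapM H) [comph _ _](_ : _ = comph (corner_hom hY _ y0) (corner_hom hZ A z)).
  by rewrite (hmapM H); apply: is_iso_comp; [exact: HY|exact: HZ].
by apply: starHom_eq => a; exact: nestE.
Qed.

End Corners.
End Stability.

(** * Compression of matrices along a frame *)

Section Frames.
Variables (l : comPzRingType) (conj : {rmorphism l -> l}).
Local Notation starAlg := (starAlg conj).

Section Multipliers.
Variable A : starAlg.
Implicit Types (a b : A).

(** An [option A] stands for a multiplier of [A]: an element, or the unit of
    the unitalization in the case of [None]. *)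
Definition lmult (u : option A) a : A := if u is Some c then smul c a else a.
Definition rmult (u : option A) a : A := if u is Some c then smul a c else a.
Definition ustar (u : option A) : option A := omap (@star l conj A) u.

Implicit Types u v : option A.

Lemma lmultD u a b : lmult u (a + b) = lmult u a + lmult u b.
Proof. by case: u => [c|]//=; rewrite smulDr. Qed.
Lemma rmultD u a b : rmult u (a + b) = rmult u a + rmult u b.
Proof. by case: u => [c|]//=; rewrite smulDl. Qed.
Lemma lmultZ u k a : lmult u (k *: a) = k *: lmult u a.
Proof. by case: u => [c|]//=; rewrite smulZr. Qed.
Lemma rmultZ u k a : rmult u (k *: a) = k *: rmult u a.
Proof. by case: u => [c|]//=; rewrite smulZl. Qed.
Lemma lmult0 u : lmult u 0 = 0.
Proof. by case: u => [c|]//=; rewrite smul0r. Qed.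
Lemma lmult_some (u a : A) : lmult (Some u) a = smul u a.
Proof. by []. Qed.
Lemma rmult_some (u a : A) : rmult (Some u) a = smul a u.
Proof. by []. Qed.
Lemma lmult_ustar (u a : A) : lmult (ustar (Some u)) a = smul (star u) a.
Proof. by []. Qed.
Lemma lmult_star0 a : lmult (ustar (Some 0)) a = 0.
Proof. by rewrite /= star0 smul0l. Qed.
Lemma rmult0 u : rmult u 0 = 0.
Proof. by case: u => [c|]//=; rewrite smul0l. Qed.
Lemma lmult_smul u a b : lmult u (smul a b) = smul (lmult u a) b.
Proof. by case: u => [c|]//=; rewrite smulA. Qed.
Lemma rmult_smul u a b : rmult u (smul a b) = smul a (rmult u b).
Proof. by case: u => [c|]//=; rewrite smulA. Qed.
Lemma smul_mult u a b : smul (rmult u a) b = smul a (lmult u b).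
Proof. by case: u => [c|]//=; rewrite smulA. Qed.
Lemma lrmultC u v a : lmult u (rmult v a) = rmult v (lmult u a).
Proof. by case: u v => [c|] [d|]//=; rewrite smulA. Qed.
Lemma star_lmult u a : star (lmult (ustar u) a) = rmult u (star a).
Proof. by case: u => [c|]//=; rewrite starM starK. Qed.
Lemma star_rmult u a : star (rmult u a) = lmult (ustar u) (star a).
Proof. by case: u => [c|]//=; rewrite starM. Qed.

Lemma rmultE u a : rmult u a = star (lmult (ustar u) (star a)).
Proof. by rewrite star_lmult starK. Qed.

End Multipliers.

Section Compression.
Variables (A : starAlg) (X J : choiceType) (h : J -> bool).
Variables (r : J -> X) (w : J -> option A).

(** The multipliers [w_j] with [r j = x] form a partition of unity for the row
    [x], as seen from [b]: finitely many [w_j^* b] are nonzero, and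
    [sum_j eps_j w_j w_j^* b = b].  The sum is required for one finite [F] only,
    since enlarging [F] adds zero terms. *)
Definition frame_at (x : X) (b : A) : Prop := exists F : {fset J},
  (forall j, r j = x -> j \notin F -> lmult (ustar (w j)) b = 0) /\
  \sum_(j <- F) (if r j == x
     then (-1) ^+ h j *: lmult (w j) (lmult (ustar (w j)) b) else 0) = b.

Lemma frame_at0 x : frame_at x 0.
Proof.
exists fset0; split=> [j _ _|]; first exact: lmult0.
by rewrite big_seq_fset0.
Qed.

Lemma frame_atD x b c : frame_at x b -> frame_at x c -> frame_at x (b + c).
Proof.
move=> [F [F0 Fb]] [F' [F'0 F'c]]; exists (F `|` F')%fset; split.
  move=> j rj; rewrite inE negb_or => /andP[jF jF'].
  by rewrite lmultD F0// F'0// addr0.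
rewrite -[in RHS]Fb -[in RHS]F'c.
rewrite [in RHS](big_fset_incl _ (fsubsetUl F F')); last first.
  by move=> j _ jF; case: eqP => // rj; rewrite F0// lmult0 scaler0.
rewrite [X in _ = _ + X](big_fset_incl _ (fsubsetUr F F')); last first.
  by move=> j _ jF; case: eqP => // rj; rewrite F'0// lmult0 scaler0.
rewrite -big_split; apply: eq_bigr => j _ /=.
by case: eqP => _; rewrite ?addr0// !lmultD scalerDr.
Qed.

Hypothesis w_frame : forall x b, frame_at x b.

(** [squeeze i j] is [a |-> eps_j w_i^* a w_j].  The single sign, on the right,
    is what makes compression compatible with products, where [eps_j] has to
    appear once for each summation index [j]. *)
Definition squeeze (i j : J) (a : A) : A :=
  (-1) ^+ h j *: lmult (ustar (w i)) (rmult (w j) a).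

Let squeezeD i j a b : squeeze i j (a + b) = squeeze i j a + squeeze i j b.
Proof. by rewrite /squeeze rmultD lmultD scalerDr. Qed.
Let squeezeZ i j k a : squeeze i j (k *: a) = k *: squeeze i j a.
Proof. by rewrite /squeeze rmultZ lmultZ !scalerA mulrC. Qed.
Let squeeze0 i j : squeeze i j 0 = 0.
Proof. by rewrite /squeeze rmult0 lmult0 scaler0. Qed.

(** Both sides are [eps_j eps_k w_i^* a w_j w_j^* b w_k]. *)
Let squeezeM i j k a b :
  squeeze i k (smul a ((-1) ^+ h j *: lmult (w j) (lmult (ustar (w j)) b))) =
  smul (squeeze i j a) (squeeze j k b).
Proof.
rewrite /squeeze !smulZr smulZl rmultZ lmultZ !scalerA; congr (_ *: _).
rewrite -[RHS]lmult_smul smul_mult !(lrmultC (ustar (w j))).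
by rewrite [in RHS]lrmultC rmult_smul.
Qed.

Let row_fin (x : X) (b : A) :
  finite_set [set j | r j = x /\ lmult (ustar (w j)) b <> 0].
Proof.
have [F [F0 _]] := w_frame x b.
apply: (@sub_finite_set _ _ [set` F]) => // j /= [rj jb].
by apply/negPn/negP => /F0 - /(_ rj).
Qed.

Definition compress_fun (m : matAlg X A) (p : J * J) : A :=
  squeeze p.1 p.2 (entry m (r p.1) (r p.2)).

Lemma compress_subproof (m : matAlg X A) :
  compress_fun m \in @fs_pred l (J * J)%type A.
Proof.
elim/mxalg_ind: m => [|x y a|m n IHm IHn].
- rewrite (_ : compress_fun 0 = 0) ?rpred0//.
  by apply/funext => p; rewrite /compress_fun [entry _ _ _]/(0 : A) squeeze0.
- apply/asboolP; apply: sub_finite_set (finite_setX (row_fin x a) (row_fin y (star a))).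
  move=> -[i j] /=; rewrite /compress_fun /= entry_delta.
  have [->|_] := eqVneq (r i) x; last by rewrite squeeze0.
  have [->|_] := eqVneq (r j) y; last by rewrite squeeze0.
  move=> ija; split; split => // a0; apply: ija.
    by rewrite /squeeze lrmultC a0 rmult0 scaler0.
  rewrite /squeeze -[rmult _ _]starK star_rmult a0.
  by rewrite star0 lmult0 scaler0.
- rewrite (_ : compress_fun (m + n) = compress_fun m + compress_fun n) ?rpredD//.
  by apply/funext => p; rewrite [LHS]squeezeD.
Qed.

Definition compress (m : matAlg X A) : mxAlg h A := Fs (compress_subproof m).

Lemma entry_compress m i j :
  entry (compress m) i j = squeeze i j (entry m (r i) (r j)).
Proof. by []. Qed.

Lemma compressD m n : compress (m + n) = compress m + compress n.
Proof. by apply: mxalgP => i j; exact: squeezeD. Qed.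

Lemma compress0 : compress 0 = 0.
Proof. by apply: mxalgP => i j; exact: squeeze0. Qed.

Lemma compress_linear : linear compress.
Proof.
move=> k m n; rewrite compressD; congr (_ + _).
by apply: mxalgP => i j; exact: squeezeZ.
Qed.
HB.instance Definition _ :=
  GRing.isLinear.Build l (matAlg X A) (mxAlg h A) _ compress compress_linear.

(** Summing over [j] with [r j = y], the partition of unity for the row [y]
    collapses the middle factors [eps_j w_j w_j^*]. *)
Lemma compressM m n : compress (smul m n) = smul (compress m) (compress n).
Proof.
elim/mxalg_ind: m => [|x y a|m m' IH IH'].
- by rewrite smul0l compress0 smul0l.
- elim/mxalg_ind: n => [|y' z b|n n' IH IH'].
  + by rewrite smul0r compress0 smul0r.
  + apply: mxalgP => i k; have [F [F0 Fb]] := w_frame y b.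
    rewrite (entry_mul (F := F)) => [|j jF]; last first.
      rewrite !entry_compress !entry_delta.
      have [rj|] := eqVneq (r j) y; last by rewrite andbF squeeze0 smul0l.
      rewrite [squeeze j k _]/squeeze lrmultC.
      by case: (_ && (r k == z)); rewrite ?(F0 _ rj jF) ?lmult0 rmult0 scaler0 smul0r.
    rewrite entry_compress mx_smul_delta.
    have [y'y|yy'] := eqVneq y y'; last first.
      rewrite [LHS]squeeze0 big1// => j _; rewrite !entry_compress !entry_delta.
      have [->|_] := eqVneq (r j) y; last by rewrite andbF squeeze0 smul0l.
      by rewrite (negPf yy') squeeze0 smul0r.
    subst y'; rewrite entry_delta.
    transitivity (\sum_(j <- F) squeeze i k (if (r i == x) && (r k == z)
      then smul a (if r j == y
        then (-1) ^+ h j *: lmult (w j) (lmult (ustar (w j)) b) else 0) else 0)).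
      case: ifP => _; last by rewrite squeeze0 big1.
      rewrite -[in LHS]Fb smul_sumr.
      by elim/big_rec2: _ => [|j c d _ <-]; rewrite ?squeeze0 ?squeezeD.
    apply: eq_bigr => j _; rewrite !entry_compress !entry_delta.
    have [_|_] := eqVneq (r i) x; last by rewrite !squeeze0 smul0l.
    have [_|_] := eqVneq (r j) y; last by rewrite smul0r !squeeze0 if_same squeeze0 smul0l.
    have [_|_] := eqVneq (r k) z; last by rewrite !squeeze0 smul0r.
    exact: squeezeM.
  + by rewrite smulDr !compressD smulDr IH IH'.
- by rewrite smulDl !compressD smulDl IH IH'.
Qed.

Lemma compress_star m : compress (star m) = star (compress m).
Proof.
apply: mxalgP => i j; rewrite entry_star !entry_compress entry_star.
rewrite expr0 mul1r scale1r /squeeze star_signZ scalerA.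
rewrite mulrAC -signr_addb addbb mul1r.
by congr (_ *: _); rewrite star_lmult star_rmult lrmultC.
Qed.

Definition compress_hom : starHom (matAlg X A) (mxAlg h A) :=
  @StarHom _ _ (matAlg X A) (mxAlg h A) compress compressM compress_star.

End Compression.
End Frames.

(** * Signed partitions of unity in a strongly graded algebra *)

Section StronglyGraded.
Variables (l : comPzRingType) (conj : {rmorphism l -> l}) (G : groupType).
Variables (R : starAlg conj) (gr : grading G R).

Lemma gr_ind (P : R -> Prop) : P 0 -> (forall g a, gpart gr g a -> P a) ->
  (forall a b, P a -> P b -> P (a + b)) -> forall a, P a.
Proof.
move=> P0 Pg PD a; rewrite (gcomps_sum gr a); apply: big_ind => // g _.
exact: Pg (gcompsP gr a g).
Qed.

Lemma gcomps_smul g h (a b : R) : gpart gr h b ->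
  gcomps gr (smul a b) (g * h)%g = smul (gcomps gr a g) b.
Proof.
move=> hb; elim/gr_ind: a => [|k a ka|a a' IH IH'].
- by rewrite smul0l !(gcomps_hom (gpart0 gr 1%g)) linear0 smul0l.
- rewrite (gcomps_hom ka) (gcomps_hom (gpartM ka hb)) !deltaE.
  by rewrite (inj_eq (mulIg h)); case: eqP => // _; rewrite smul0l.
- by rewrite smulDl !gcompsD !fsDE IH IH' smulDl.
Qed.

Variable e : R.
Hypothesis eP : forall a, smul e a = a /\ smul a e = a.

Lemma unit_star : star e = e.
Proof. by rewrite -[LHS](eP _).1 -{1}[e]starK -starM (eP _).1 starK. Qed.

(** For homogeneous [b] of degree [h], the component of degree [h] of
    [e b = b] is [e_1 b]; so [e_1] is a left unit, hence equal to [e]. *)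
Lemma unit_deg1 : gpart gr 1%g e.
Proof.
have e1P a : smul (gcomps gr e 1%g) a = a.
  elim/gr_ind: a => [|h b hb|a a' IH IH']; first exact: smul0r.
    by rewrite -(gcomps_smul 1%g e hb) mul1g (eP b).1 (gcomps_hom hb) deltaE eqxx.
  by rewrite smulDr IH IH'.
by rewrite -(e1P e) (eP _).2; exact: gcompsP.
Qed.

Variable lam : l.
Hypotheses (conjK : involutive conj) (lamP : lam + conj lam = 1).

(** The hyperbolic form [[0, 1], [1, 0]] is [P diag(1, -1) P^*] for the matrix
    [P = [[lam, - lam^*], [1, 1]]], since [lam + lam^* = 1]; and [(x, y)] is
    [(u, v) P]. *)
Lemma hyperbolic_split (u v : R) :
  let x := lam *: u + v in let y := v - conj lam *: u in
  smul x (star x) - smul y (star y) = smul u (star v) + smul v (star u).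
Proof.
rewrite /= !starD !starZ -!scaleNr !starZ !rmorphN conjK.
rewrite !(smulDl, smulDr, smulZl, smulZr) !scalerA.
rewrite mulrNN [conj lam * lam]mulrC !opprD -!scaleNr !opprK.
rewrite [LHS](AC (2*2*(2*2)) ((1*8)*(4*5)*((3*7)*(2*6))))%AC /= -!scalerDl.
by rewrite [conj lam + lam]addrC lamP !subrr scale0r !add0r !scale1r.
Qed.

Hypothesis gr_strong : strongly_graded gr.

Lemma signed_partition_of_unity g : exists s : seq (R * R),
  (forall p, p \in s -> gpart gr g p.1 /\ gpart gr g p.2) /\
  \sum_(p <- s) (smul p.1 (star p.1) - smul p.2 (star p.2)) = e.
Proof.
have : gpart_prod gr g g^-1%g e by rewrite gr_strong mulgV; exact: unit_deg1.
case=> s sP es.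
(* The products a b sum up to 1, hence so do the self-adjoint elements
   lam a b + (lam a b)^*, which are hyperbolic terms for u = lam a and v = b^*. *)
pose f (p : R * R) : R * R := let u := lam *: p.1 in
  (lam *: u + star p.2, star p.2 - conj lam *: u).
exists (map f s); split.
  move=> _ /mapP[p /sP [ap bp] ->].
  have := gpart_star bp; rewrite invgK => bp'.
  split; apply: gpartD => //; first by do 2!apply: gpartZ.
  by rewrite -scaleNr; do 2!apply: gpartZ.
rewrite big_map (eq_bigr (fun p => lam *: smul p.1 p.2 +
  conj lam *: star (smul p.1 p.2))).
  rewrite big_split -!scaler_sumr /= -es.
  rewrite (_ : \sum_(p <- s) star (smul p.1 p.2) = e).
    by rewrite -scalerDl lamP scale1r.
  rewrite -[RHS]unit_star es.
  by elim/big_rec2: _ => [|p a b _ ->]; rewrite ?star0// starD.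
by move=> p _; rewrite hyperbolic_split starK starZ smulZl smulZr starM.
Qed.

End StronglyGraded.

(** * The frame of the crossed product *)

Section CornerOfCrossedProduct.
Variables (l : comPzRingType) (conj : {rmorphism l -> l}) (G : groupType).
Variables (R : starAlg conj) (gr : grading G R).
Local Notation C := (crossedProd gr).
Local Notation chi g b := (delta g b : C).

Lemma smul_chi g h s b c : gpart gr s b ->
  smul (chi g b) (chi h c) = if h == (g * s)%g then chi g (smul b c) else 0.
Proof. by move=> sb; exact: cp_mul_delta. Qed.

Lemma star_chi g s b : gpart gr s b -> star (chi g b) = chi (g * s)%g (star b).
Proof. by move=> sb; exact: cp_star_delta. Qed.

Lemma star_chiV g z : gpart gr g^-1%g z -> star (chi g z) = chi 1%g (star z).
Proof. by move=> zg; rewrite (star_chi _ zg) mulgV. Qed.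

Lemma deg1_hom_inj : injective (deg1_hom gr).
Proof.
move=> a b /(congr1 (fun f : C => fs_val f 1%g)).
by rewrite /= !eqxx => /val_inj.
Qed.

Lemma chi_ind (P : C -> Prop) : P 0 -> (forall g b, P (chi g b)) ->
  (forall c c', P c -> P c' -> P (c + c')) -> forall c, P c.
Proof. exact: fs_ind. Qed.

(** [chi_1 z c chi_h z'] starts at the vertex [1] of [G] and, [z'] having
    degree [h^-1], also ends there. *)
Lemma chi1_smul_range z c h z' : gpart gr h^-1%g z' ->
  exists a, deg1_hom gr a = smul (smul (chi 1%g z) c) (chi h z').
Proof.
move=> z'h.
have [d ->] : exists d : R, smul (chi 1%g z) c = chi 1%g d.
  elim/chi_ind: c => [|k b|c c' [d cd] [d' cd']].
  - by exists 0; rewrite smul0r linear0.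
  - exists (smul (gcomps gr z k) b).
    elim/(@gr_ind _ _ _ _ gr): z => [|s z sz|y y' IH IH'].
    + by rewrite linear0 smul0l (gcomps_hom (gpart0 gr 1%g)) linear0 smul0l linear0.
    + rewrite (smul_chi _ _ _ sz) mul1g (gcomps_hom sz) deltaE.
      by case: eqP => // _; rewrite smul0l linear0.
    + by rewrite linearD smulDl IH IH' gcompsD fsDE smulDl linearD.
  - by exists (d + d'); rewrite smulDr cd cd' linearD.
elim/(@gr_ind _ _ _ _ gr): d => [|s d sd|d d' [a ad] [a' ad']].
- by exists 0; rewrite !linear0 smul0l.
- rewrite (smul_chi _ _ _ sd) mul1g.
  case: eqP => [hs|_]; last by exists 0; rewrite linear0.
  subst s; have dz := gpartM sd z'h; rewrite mulgV in dz.
  by exists (Deg1 (asboolT dz)).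
- by exists (a + a'); rewrite !linearD smulDl ad ad'.
Qed.

Section CrossedFrame.
Variables (e : R) (t : G -> seq (R * R)).
Hypothesis eP : forall a, smul e a = a /\ smul a e = a.
Hypothesis tP : forall g,
  (forall p, p \in t g -> gpart gr g^-1%g p.1 /\ gpart gr g^-1%g p.2) /\
  \sum_(p <- t g) (smul p.1 (star p.1) - smul p.2 (star p.2)) = e.
Hypothesis t1 : t 1%g = [:: (e, 0)].

Variables (X : choiceType) (p : G + nat -> X) (dec : X -> option (G + nat)).
Hypotheses (pK : pcancel p dec) (decK : ocancel dec p).
Local Notation J := (X * X * bool)%type.
Let h (v : J) := v.2.
Let x0 := p (inr 0%N).

Definition frame_coef (g : G) (n : nat) (b : bool) : R :=
  let q := nth (0, 0) (t g) n in if b then q.2 else q.1.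

(** With [q = p (inr n)] as second coordinate, an index [(x, q, b)] plays one of
    two roles.  For [n = 0] and [b = false] it carries the unit multiplier in the
    row [x], if [x <> x0]; for [n > 0] and [x = p (inl g)] it carries
    [chi_g z] in the row [x0], where [z] is the member number [n - 1] and sign [b]
    of the partition of unity [t g].  All other indices carry the multiplier 0. *)
Definition frame_row (j : J) : X := if j.1.2 == x0 then j.1.1 else x0.

Definition frame_mult (j : J) : option C :=
  match dec j.1.2 with
  | Some (inr 0%N) => if j.2 || (j.1.1 == x0) then Some 0 else None
  | Some (inr n.+1) =>
      if dec j.1.1 is Some (inl g) then Some (chi g (frame_coef g n j.2))
      else Some 0
  | _ => Some 0
  end.

Let p_inj : injective p := pcan_inj pK.

Lemma frame_coef_gpart g n b : gpart gr g^-1%g (frame_coef g n b).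
Proof.
rewrite /frame_coef; have [nt|tn] := ltnP n (size (t g)); last first.
  by rewrite nth_default//; case: b; exact: gpart0.
by have [] := (tP g).1 _ (mem_nth (0, 0) nt); case: b.
Qed.

Lemma frame_mult_x0 j : frame_row j = x0 ->
  exists g z, gpart gr g^-1%g z /\ frame_mult j = Some (chi g z).
Proof.
have Some0 : exists g z, gpart gr g^-1%g z /\ Some (0 : C) = Some (chi g z).
  by exists 1%g, 0; split; [exact: gpart0|rewrite linear0].
case: j => -[x y] b; rewrite /frame_row /frame_mult /=.
move: (decK y); case: (dec y) => [[g|[|n]]|] /= yE; rewrite -?yE //.
  by rewrite eqxx => ->; rewrite eqxx orbT.
move=> _; case: (dec x) => [[g|?]|] //.
by exists g, (frame_coef g n b); split=> //; exact: frame_coef_gpart.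
Qed.

Lemma frame_mult_other x j : frame_row j = x -> x != x0 ->
  j != (x, x0, false) -> frame_mult j = Some 0.
Proof.
case: j => -[x' y] b; rewrite /frame_row /frame_mult /=.
case: eqP => [-> -> xx0|_ ->]; last by rewrite eqxx.
by rewrite pK !xpair_eqE !eqxx /=; case: b.
Qed.

Lemma frame_mult_diag x : x != x0 -> frame_mult (x, x0, false) = None.
Proof. by move=> /negPf xx0; rewrite /frame_mult /= pK xx0. Qed.

Lemma frame_mult_p g n b :
  frame_mult (p (inl g), p (inr n.+1), b) = Some (chi g (frame_coef g n b)).
Proof. by rewrite /frame_mult /= !pK. Qed.

Lemma frame_row_p g n b : frame_row (p (inl g), p (inr n.+1), b) = x0.
Proof. by rewrite /frame_row /=; case: eqP => // /p_inj. Qed.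

Lemma lmult_frame_p g n b d c :
  lmult (ustar (frame_mult (p (inl g), p (inr n.+1), b))) (chi d c) =
  if d == g then chi 1%g (smul (star (frame_coef g n b)) c) else 0.
Proof.
rewrite frame_mult_p lmult_ustar; have zg := frame_coef_gpart g n b.
have := gpart_star zg; rewrite invgK => zg'.
by rewrite (star_chiV zg) (smul_chi _ _ _ zg') mul1g.
Qed.

Lemma frame_support j d c : frame_row j = x0 ->
  lmult (ustar (frame_mult j)) (chi d c) <> 0 ->
  exists n b, (n < size (t d))%N /\ j = (p (inl d), p (inr n.+1), b).
Proof.
case: j => -[x y] b; rewrite {1}/frame_row /=.
move: (decK y); case yE: (dec y) => [[g|[|n]]|] /=;
  try by rewrite /frame_mult /= yE lmult_star0.
  by move=> <-; rewrite eqxx => ->; rewrite /frame_mult /= pK eqxx orbT lmult_star0.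
move=> yn _; move: (decK x); case xE: (dec x) => [[g|?]|] /= xg;
  try by rewrite /frame_mult /= yE xE lmult_star0.
rewrite -yn -xg lmult_frame_p; have [-> z0|_] := eqVneq d g; last by [].
exists n, b; split=> //; rewrite ltnNge; apply/negP => tn; apply: z0.
by rewrite /frame_coef nth_default//; case: b; rewrite /= star0 smul0l linear0.
Qed.

Lemma signed_pair d (a b c : R) :
  (-1) ^+ 0 *: chi d (smul a (smul (star a) c)) +
  ((-1) ^+ 1 *: chi d (smul b (smul (star b) c)) + 0) =
  chi d (smul (smul a (star a) - smul b (star b)) c).
Proof.
rewrite expr0 expr1 scale1r scaleN1r addr0 !smulA -linearB.
by rewrite smulDl -[- smul b _]scaleN1r smulZl scaleN1r.
Qed.

(** Only the members coming from [t d] see [chi_d c], and on it they sum up to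
    left multiplication by [chi_d 1]. *)
Lemma frame_x0 d c : frame_at h frame_row frame_mult x0 (chi d c).
Proof.
pose s := [seq (p (inl d), p (inr n.+1), b)
  | n <- iota 0 (size (t d)), b <- [:: false; true]].
have us : uniq s.
  apply: allpairs_uniq; rewrite ?iota_uniq//.
  by move=> -[n b] [n' b'] _ _ [] /p_inj [->] ->.
exists [fset j in s]%fset; split=> [j rj|].
  apply: contraNeq => /eqP /(frame_support rj) [n [b [nt ->]]].
  rewrite inE; apply/allpairsP; exists (n, b); split=> //=.
    by rewrite mem_iota.
  by case: b.
rewrite (perm_big s)/=; last first.
  by apply: uniq_perm => [|//|j]; [exact: fset_uniq|rewrite inE].
rewrite big_allpairs_dep.
transitivity (chi d (smul e c)); last by rewrite (eP c).1.
rewrite -(tP d).2 (big_nth (0, 0)) smul_suml linear_sum /index_iota subn0.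
apply: eq_bigr => n _.
rewrite !big_cons big_nil !frame_row_p !eqxx !lmult_frame_p !eqxx
  !frame_mult_p !lmult_some.
rewrite !(smul_chi _ _ _ (frame_coef_gpart _ _ _)) mulgV eqxx.
exact: signed_pair.
Qed.

Lemma crossed_frame x (c : C) : frame_at h frame_row frame_mult x c.
Proof.
have [->|xx0] := eqVneq x x0.
  elim/chi_ind: c => [|d c|c c']; first exact: frame_at0.
    exact: frame_x0.
  exact: frame_atD.
exists [fset (x, x0, false)]%fset; split=> [j rj|].
  by rewrite inE => jx; rewrite (frame_mult_other rj xx0 jx) lmult_star0.
rewrite big_seq_fset1 frame_mult_diag// /frame_row /= !eqxx.
by rewrite expr0 scale1r.
Qed.

Definition crossed_compress : starHom (matAlg X C) (mxAlg h C) :=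
  compress_hom crossed_frame.

(** Off [x0] the frame has a single unit multiplier in each row, so that
    compression only relabels the corner; this makes it invertible in any
    theory that inverts the corner inclusions. *)
Lemma crossed_compress_corner x : x != x0 ->
  comph crossed_compress (mat_corner x C) = corner_hom h C (x, x0, false).
Proof.
move=> xx0; apply: starHom_eq => c; apply: mxalgP => i j /=.
rewrite [LHS]entry_compress !entry_delta /squeeze.
have off k : frame_row k == x -> k != (x, x0, false) -> frame_mult k = Some 0.
  by move=> /eqP rk; exact: frame_mult_other.
have rx : frame_row (x, x0, false) = x by rewrite /frame_row /= eqxx.
have [->|ix] := eqVneq i (x, x0, false); last first.
  have [/eqP rix|_] := eqVneq (frame_row i) x.
    by rewrite (off i rix ix) lmult_star0 scaler0.
  by rewrite rmult0 lmult0 scaler0.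
rewrite rx eqxx /=.
have [->|jx] := eqVneq j (x, x0, false).
  by rewrite rx eqxx frame_mult_diag//= expr0 scale1r.
have [/eqP rjx|_] := eqVneq (frame_row j) x.
  by rewrite (off j rjx jx) rmult_some smul0r lmult0 scaler0.
by rewrite rmult0 lmult0 scaler0.
Qed.

Lemma crossed_compress_range c i j : exists a, deg1_hom gr a =
  entry (comph crossed_compress (mat_corner x0 C) c) i j.
Proof.
rewrite [entry _ _ _](_ : _ = squeeze h frame_mult i j
  (entry (delta (x0, x0) c : matAlg X C) (frame_row i) (frame_row j)))//.
rewrite entry_delta.
have range0 : exists a, deg1_hom gr a = squeeze h frame_mult i j 0.
  by exists 0; rewrite linear0 /squeeze rmult0 lmult0 scaler0.
have [ri|_] := eqVneq (frame_row i) x0; last exact: range0.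
have [rj|_] := eqVneq (frame_row j) x0; last exact: range0.
have [g [z [zg wi]]] := frame_mult_x0 ri.
have [g' [z' [zg' wj]]] := frame_mult_x0 rj.
rewrite /squeeze wi wj rmult_some lmult_ustar (star_chiV zg) smulA.
have [a aE] := chi1_smul_range (star z) c zg'.
by exists ((-1) ^+ h j *: a); rewrite linearZ; congr (_ *: _).
Qed.

(** By the choice [t 1 = [:: (e, 0)]], the only frame member that sees [chi_1 a]
    is [chi_1 1]. *)
Lemma crossed_compress_deg1 :
  comph (comph crossed_compress (mat_corner x0 C)) (deg1_hom gr) =
  comph (corner_hom h C (p (inl 1%g), p (inr 1%N), false)) (deg1_hom gr).
Proof.
apply: starHom_eq => a; apply: mxalgP => i j.
set v := (_, _, false).
rewrite [LHS](_ : _ = squeeze h frame_mult i j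
  (entry (delta (x0, x0) (deg1_hom gr a) : matAlg X C) (frame_row i) (frame_row j)))//.
rewrite [RHS]entry_delta entry_delta.
have deg1P := deg1P a.
have rv : frame_row v = x0 by exact: frame_row_p.
have c1 : frame_coef 1 0 false = e by rewrite /frame_coef t1.
have wv : frame_mult v = Some (chi 1%g e) by rewrite frame_mult_p c1.
have off k (b : R) : frame_row k = x0 -> k != v ->
    lmult (ustar (frame_mult k)) (chi 1%g b) = 0.
  move=> rk; apply: contraNeq => /eqP kb; have [n [b' [+ kE]]] := frame_support rk kb.
  rewrite t1 ltnS leqn0 => /eqP n0; subst n.
  case: b' kE => kE; last by rewrite kE.
  by case: kb; rewrite kE lmult_frame_p eqxx /frame_coef t1 /= star0 smul0l linear0.
have sq0 : squeeze h frame_mult i j 0 = 0 by rewrite /squeeze rmult0 lmult0 scaler0.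
have [ri|ri] := eqVneq (frame_row i) x0; last first.
  by rewrite sq0; case: (eqVneq i v) ri => // ->; rewrite rv eqxx.
have [rj|rj] := eqVneq (frame_row j) x0; last first.
  by rewrite sq0; case: (eqVneq j v) rj => [->|]; rewrite ?rv ?eqxx// andbF.
rewrite -[deg1_hom gr a]/(chi 1%g (deg1_val a)).
have [->|iv] := eqVneq i v; last first.
  by rewrite /squeeze lrmultC off// rmult0 scaler0.
have [->|jv] := eqVneq j v; last first.
  rewrite /squeeze rmultE (star_chi _ deg1P) mulg1 off//.
  by rewrite star0 lmult0 scaler0.
have e1 : gpart gr 1%g e := unit_deg1 gr eP.
rewrite /squeeze wv rmult_some (smul_chi _ _ _ deg1P) mulg1 eqxx (eP _).2.
rewrite lmult_ustar (star_chi _ e1) mulg1 (unit_star eP).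
by rewrite (smul_chi _ _ _ e1) mulg1 eqxx (eP _).1 expr0 scale1r.
Qed.

End CrossedFrame.
End CornerOfCrossedProduct.

(** * The equivalence *)

Lemma card_le_retraction (S X : Type) :
  ([set: S]%classic #<= [set: X]%classic)%card ->
  exists (p : S -> X) (dec : X -> option S), pcancel p dec /\ ocancel dec p.
Proof.
move=> /card_leP[q].
pose p (s : S) : X :=
  val (q (exist (fun s => s \in [set: S]%classic) s (mem_set I))).
have p_inj : injective p.
  by move=> s s' /val_inj /inj => /(_ (mem_set I) (mem_set I)) [].
have /choice[dec decP] x : exists o,
    if o is Some s then p s = x else forall s, p s <> x.
  have [[s sx]|nx] := pselect (exists s, p s = x).
    by exists (Some s).
  by exists None => s sx; apply: nx; exists s.
exists p, dec; split=> [s|x].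
  by move: (decP (p s)); case: (dec _) => [s' /p_inj->//|/(_ s)].
by move: (decP x); case: (dec x).
Qed.

Section HermitianStability.
Variables (l : comPzRingType) (conj : {rmorphism l -> l}).
Variables (Ob : Type) (T : triCat Ob) (H0 : starAlg conj -> Ob).
Variables (H : excisiveTheory T H0) (X : choiceType).

(** Only the corners with sign [+] are reached: the stability axiom for [M_pm]
    concerns the upper-left corner. *)
Lemma signed_corner_iso (A : starAlg conj) (x y : X) :
  mat_stable H X -> iota_stable H ->
  is_iso (H _ _ (corner_hom (fun v : X * X * bool => v.2) A (x, y, false))).
Proof.
move=> HX Hpm.
have HX1 : corners_inverted H (fun _ : X => false) by move=> B z _; exact: HX.
have HX2 : corners_inverted H (fun _ : X * X => false).
  by move=> B [z z'] _; exact: (corners_inverted_prod HX1 HX1 (erefl : _ z = _)).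
have Hpm' : corners_inverted H (id : bool -> bool).
  by move=> B [] //= _; exact: Hpm.
exact: (corners_inverted_prod HX2 Hpm' (erefl : _ (x, y) = _)).
Qed.

End HermitianStability.

Theorem theorem10p1
  (l : comPzRingType) (conj : {rmorphism l -> l})
  (hconj : involutive conj)
  (lam : l) (hlam : (lam + conj lam = 1)%R)
  (G : groupType)
  (X : choiceType) (hX : infinite_set [set: X]%classic)
  (hGX : ([set: (G + nat)%type]%classic #<= [set: X]%classic)%card)
  (kk : triCat (starAlg conj)) (j : excisiveTheory kk (fun A => A))
  (hj : is_jh X j)
  (R : starAlg conj) (hR : unital R)
  (gr : grading G R) (hgr : strongly_graded gr) :
  is_iso (j (deg1Alg gr) (crossedProd gr) (deg1_hom gr)).
Proof.
have [[_ jX jpm] _] := hj; have [e eP] := hR.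
have [p [dec [pK decK]]] := card_le_retraction hGX.
have e1 := unit_deg1 gr eP.
have /choice[t tP] g : exists s : seq (R * R),
    ((forall q, q \in s -> gpart gr g^-1%g q.1 /\ gpart gr g^-1%g q.2) /\
     \sum_(q <- s) (smul q.1 (star q.1) - smul q.2 (star q.2)) = e) /\
    (g = 1%g -> s = [:: (e, 0)]).
  have [->|g1] := eqVneq g 1%g.
    exists [:: (e, 0)]; split=> //; rewrite invg1 big_seq1 /= smul0l subr0.
    rewrite unit_star//; split; last exact: (eP e).1.
    by move=> q; rewrite inE => /eqP->; split=> //; exact: gpart0.
  have [s sP] := signed_partition_of_unity eP hconj hlam hgr g^-1%g.
  by exists s; split=> // /eqP; rewrite (negPf g1).
pose Th := crossed_compress eP (fun g => (tP g).1) pK decK.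
pose x0 := p (inr 0%N); pose x1 := p (inr 1%N).
have x10 : x1 != x0 by apply/eqP => /(pcan_inj pK).
pose psi := comph Th (mat_corner x0 (crossedProd gr)).
(* Comparison of the corners of Theta at x0 and at x1. *)
have psi_iso : is_iso (j _ _ psi).
  rewrite (hmapM j); apply: is_iso_comp; last exact: jX.
  apply: is_iso_cancelr (jX _ x1) _.
  rewrite -(hmapM j) (crossed_compress_corner eP (fun g => (tP g).1) pK decK x10).
  exact: signed_corner_iso.
have [phi phiE] : exists phi, comph (mx_hom _ (deg1_hom gr)) phi = psi.
  apply: starHom_factor; first exact/mx_hom_inj/deg1_hom_inj.
  move=> c; apply: mx_hom_range => i i'.
  exact: (crossed_compress_range eP (fun g => (tP g).1) pK decK).
pose v : X * X * bool := (p (inl 1%g), p (inr 1%N), false).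
have phi_deg1 : comph phi (deg1_hom gr) = corner_hom _ _ v.
  apply: starHom_eq => a; apply: (mx_hom_inj (f := deg1_hom gr)) => //.
    exact: deg1_hom_inj.
  have := crossed_compress_deg1 eP (fun g => (tP g).1) ((tP 1%g).2 erefl) pK decK.
  rewrite -/psi -phiE -corner_natural => /(congr1 (fun f : starHom _ _ => f a)).
  exact.
apply: (@is_iso_2of6 _ _ _ _ _ _ (j _ _ (mx_hom _ (deg1_hom gr))) (j _ _ phi)).
  by rewrite -(hmapM j) phi_deg1; exact: signed_corner_iso.
by rewrite -(hmapM j) phiE.
Qed.
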